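(* Let $M_t(z)=F_t(z)-z-i\frac{\pi}{2}t$ be the fluctuation field of the backwards stationary Hastings–Levitov$(0)$ process (defined in the context). There exists $c>0$ such that for every $\beta>0$ large enough and every $t>0$ large enough, $$\mathbf{P}\Big(\max_{x\in[0,t]}\operatorname{Im} M_t(x)>\beta\log t\Big)<\frac{c}{t^{1/2}}.$$
   Context: Let $\mathbb{H}=\{z\in\mathbb{C}:\operatorname{Im} z>0\}$. For $x\in\mathbb{R}$ let $\varphi_x(z)=x+\sqrt{(z-x)^2-1}$, using the branch of the square root with positive imaginary part. Let $\mathcal{A}$ be a Poisson point process of intensity $1$ on $\mathbb{R}\times\mathbb{R}_+$. For $m>0$, order the points of $\mathcal{A}\cap([-m,m]\times\mathbb{R}_+)$ by their second coordinate as $(x_1,t_1),(x_2,t_2),\dots$ and set $F^m_t(z)=z$ for $t<t_1$ and $F^m_t(z)=\varphi_{x_k}\circ\cdots\circ\varphi_{x_1}(z)$ for $t_k\le t<t_{k+1}$. The backwards SHL$(0)$ is $F_t(z)=\lim_{m\to\infty}F^m_t(z)$ for $z\in\mathbb{H}\cup\mathbb{R}$, and $M_t(z)=F_t(z)-z-i\frac{\pi}{2}t$ (a zero-mean martingale in $t$). *)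

(* Defs.v *)
From HB Require Import structures.
From mathcomp Require Import all_boot all_order all_algebra.
From mathcomp Require Import all_classical all_reals all_analysis.
From mathcomp Require Import complex finmap.
Set Implicit Arguments.
Unset Strict Implicit.
Unset Printing Implicit Defensive.
Import Order.TTheory GRing.Theory Num.Theory.
Import numFieldTopology.Exports numFieldNormedType.Exports.
Local Open Scope classical_set_scope.
Local Open Scope ring_scope.
Local Open Scope complex_scope.

(* phi_x(z) = x + sqrt((z-x)^2 - 1), square root branch with positive imaginary
   part (for z in H this root is unique).  For real z (boundary values) the
   root is real or purely imaginary; we use the continuous extension from H:
   i sqrt(1-(z-x)^2) if |z-x|<1, sign(z-x) sqrt((z-x)^2-1) if |z-x|>=1. *)
Definition sqrt_branch (R : rcfType) (u : R[i]) : R[i] :=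
  let s := sqrtc (u ^+ 2 - 1) in
  if 0 < complex.Im s then s
  else if complex.Im s < 0 then - s
  else if complex.Re u < 0 then - s else s.

Definition phi (R : rcfType) (x : R) (z : R[i]) : R[i] :=
  x%:C + sqrt_branch (z - x%:C).

Definition compose_maps (R : rcfType) (s : seq (R * R)) (z : R[i]) : R[i] :=
  foldl (fun w p => phi p.1 w) z s.

(* F^m_t(z): compose the maps of the points of A in [-m,m] x (-oo,t] in
   increasing order of their time coordinate (identity if there is no such
   finite, strictly time-ordered enumeration). *)
Definition Fm (R : realType) (A : set (R * R)) (m t : R) (z : R[i]) : R[i] :=
  let S := A `&` [set p | - m <= p.1 <= m /\ p.2 <= t] in
  match pselect (exists s : seq (R * R),
                   sorted (fun p q : R * R => p.2 < q.2) s /\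
                   [set p | p \in s] = S) with
  | left h => compose_maps (proj1_sig (cid h)) z
  | right _ => z
  end.

Definition F (R : realType) (A : set (R * R)) (t : R) (z : R[i]) : R[i] :=
  (lim ((fun m : R => (complex.Re (Fm A m t z) : R)) @ +oo%R))
    +i* (lim ((fun m : R => (complex.Im (Fm A m t z) : R)) @ +oo%R)).

Definition M (R : realType) (A : set (R * R)) (t : R) (z : R[i]) : R[i] :=
  F A t z - z - 'i * (pi / 2 * t)%:C.

Definition bounded_set (R : realType) (B : set (R * R)) : Prop :=
  exists r : R, B `<=` [set p | `|p.1| <= r /\ `|p.2| <= r].

(* number of points of the configuration A in B (0 if infinitely many) *)
Definition npoints (R : realType) (A B : set (R * R)) : nat :=
  (#|` fset_set (A `&` B)|)%fset.

Definition leb2 (R : realType) : set (R * R) -> \bar R :=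
  ((@lebesgue_measure R) \x (@lebesgue_measure R))%E.

Definition poisson_p (R : realType) (l : R) (k : nat) : R :=
  expR (- l) * l ^+ k / k`!%:R.

Definition poisson_point_process (R : realType) (d : measure_display)
    (T : measurableType d) (P : probability T R) (A : T -> set (R * R)) : Prop :=
  (forall w, A w `<=` [set p | 0 <= p.2]) /\
  (forall w B, bounded_set B -> finite_set (A w `&` B)) /\
  (forall (n : nat) (B : 'I_n -> set (R * R)) (k : 'I_n -> nat),
     (forall i, measurable (B i) /\ bounded_set (B i) /\
                B i `<=` [set p | 0 <= p.2]) ->
     (forall i j, i != j -> B i `&` B j = set0) ->
     measurable [set w | forall i, npoints (A w) (B i) = k i] /\
     P [set w | forall i, npoints (A w) (B i) = k i] =
       (\prod_(i < n) poisson_p (fine (@leb2 R (B i))) (k i))%:E).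

(* Main.v *)
(* A first moment bound on the derivative of the flow. One map [phi x] raises the
   height [y = Im z] by [h >= 0], where [h <= min(1, 1/(2y))] and the integral of
   [h] over [x] is at most [pi/2]; it stretches distances by [|phi_x'(z)|], where
   the integral of [|phi_x'(z)| - 1] is at most [4] and [|phi_x'(z)| - 1 = O(h/y)]
   for [y >= 1]. Hence, for [f(y) = exp(4y) / (1+y)^a] with [a] large, both
   [E f(Im F_t)] and [E |F_t'| f(Im F_t)] grow at most like [exp(2 pi t)].
   Integrating [|d/dx f(Im F_t(x))| <= C |F_t'| f(Im F_t)] over [[0, t]] bounds
   [E max_x f(Im F_t(x))] by [C t exp(2 pi t)], and Markov's inequality at height
   [pi t / 2 + beta log t] yields a probability of order [t^(a + 1 - 4 beta)].

   Only the numbers of points in boxes are measurable by hypothesis, so [R] is cut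
   into cells and time into slices with at most one point each, and the boundary
   points into a net at height [e > 0]; the maps [phi x] are uniformly continuous
   on the closed half-plane, derivatives become differences and integrals become
   Riemann sums. As [m] tends to infinity, Fatou's lemma suffices. *)
Require Import Defs.
From HB Require Import structures.
From mathcomp Require Import all_boot all_order all_algebra.
From mathcomp Require Import all_classical all_reals all_analysis.
From mathcomp Require Import complex finmap.
From mathcomp Require Import ring lra.
Import Order.TTheory GRing.Theory Num.Theory.
Import numFieldTopology.Exports numFieldNormedType.Exports.
Local Open Scope classical_set_scope.
Local Open Scope ring_scope.
Local Open Scope complex_scope.

Local Notation Re := complex.Re.
Local Notation Im := complex.Im.
Local Notation normc := Normc.normc.

(** * The square root branch *)

Section SqrtBranch.
Context {R : rcfType}.
Implicit Types u v w z : R[i].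

Lemma ReD u v : Re (u + v) = Re u + Re v. Proof. by case: u v => [? ?] []. Qed.
Lemma ImD u v : Im (u + v) = Im u + Im v. Proof. by case: u v => [? ?] []. Qed.
Lemma ReN u : Re (- u) = - Re u. Proof. by case: u. Qed.
Lemma ImN u : Im (- u) = - Im u. Proof. by case: u. Qed.
Lemma ReB u v : Re (u - v) = Re u - Re v. Proof. by rewrite ReD ReN. Qed.
Lemma ImB u v : Im (u - v) = Im u - Im v. Proof. by rewrite ImD ImN. Qed.

Lemma normcN u : normc (- u) = normc u.
Proof. by case: u => a b /=; rewrite !sqrrN. Qed.

Lemma normcB u v : normc (u - v) = normc (v - u).
Proof. by rewrite -normcN opprB. Qed.

Lemma normc_ge0 u : 0 <= normc u.
Proof. by case: u => a b; rewrite sqrtr_ge0. Qed.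

Lemma normc_sqr u : normc u ^+ 2 = Re u ^+ 2 + Im u ^+ 2.
Proof. by case: u => a b /=; rewrite sqr_sqrtr // addr_ge0 // sqr_ge0. Qed.

Lemma le_normc u v : Re u ^+ 2 + Im u ^+ 2 <= Re v ^+ 2 + Im v ^+ 2 -> normc u <= normc v.
Proof. by case: u v => [a b] [c d] /=; exact: ler_wsqrtr. Qed.

Lemma normc_Re u : `|Re u| <= normc u.
Proof.
by case: u => a b /=; rewrite -sqrtr_sqr ler_wsqrtr // lerDl sqr_ge0.
Qed.

Lemma normc_Im u : `|Im u| <= normc u.
Proof.
by case: u => a b /=; rewrite -sqrtr_sqr ler_wsqrtr // lerDr sqr_ge0.
Qed.

Lemma normcD u v : normc (u + v) <= normc u + normc v.
Proof. exact: (@le_normcD R u v). Qed.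

Lemma normc_le_ReIm u : normc u <= `|Re u| + `|Im u|.
Proof.
rewrite -(@ler_pXn2r _ 2) ?nnegrE ?addr_ge0 ?normc_ge0 // normc_sqr.
rewrite sqrrD !real_normK ?num_real // -subr_ge0.
rewrite (_ : _ - _ = `|Re u| * `|Im u| *+ 2); last by ring.
by rewrite mulrn_wge0 // mulr_ge0.
Qed.

Lemma sqrt_branch_sqr u : sqrt_branch u ^+ 2 = u ^+ 2 - 1.
Proof.
rewrite /sqrt_branch; set s := sqrtc _.
have ss : s ^+ 2 = u ^+ 2 - 1 by exact: sqr_sqrtc.
case: ifP => _ //; case: ifP => _; first by rewrite sqrrN.
by case: ifP => _; rewrite ?sqrrN.
Qed.

Lemma sqrt_branch_Im_ge0 u : 0 <= Im (sqrt_branch u).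
Proof.
rewrite /sqrt_branch; set s := sqrtc _.
case: ltP => [/ltW //|s0]; case: ltP => [s1|s1]; first by rewrite ImN oppr_ge0.
have s2 : Im s = 0 by apply/le_anti; rewrite s0 s1.
by case: ifP; rewrite ?ImN s2 ?oppr0.
Qed.

Lemma sqrt_branch_Re u : Re (sqrt_branch u) ^+ 2 - Im (sqrt_branch u) ^+ 2 = Re u ^+ 2 - Im u ^+ 2 - 1.
Proof.
have := congr1 (@complex.Re R) (sqrt_branch_sqr u).
by move: (sqrt_branch u) => v; case: u v => [x y] [p q] /=; rewrite -!expr2.
Qed.

Lemma sqrt_branch_Im u : Re (sqrt_branch u) * Im (sqrt_branch u) = Re u * Im u.
Proof.
have := congr1 (@complex.Im R) (sqrt_branch_sqr u).
by move: (sqrt_branch u) => v; case: u v => [x y] [p q] /=; lra.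
Qed.

(** Where the root [v] has positive height, the sign follows from [Re v * Im v = Re u * Im u]; at
    height 0 it is the sign convention built into [sqrt_branch]. *)
Lemma sqrt_branch_ReM u : 0 <= Im u -> 0 <= Re u * Re (sqrt_branch u).
Proof.
move=> u0; have := sqrt_branch_Im u; have := sqrt_branch_Im_ge0 u.
rewrite le_eqVlt => /orP[/eqP q0 _|q0 e]; last first.
  by rewrite -(pmulr_lge0 _ q0) -mulrA e mulrA -expr2 mulr_ge0 // sqr_ge0.
move: q0; rewrite /sqrt_branch; set s := sqrtc _.
have s0 : 0 <= Re s by rewrite /s; case: (u ^+ 2 - 1) => a b /=; exact: sqrtr_ge0.
have [s1 s2|s1] := ltrP 0 (Im s); first by rewrite -s2 ltxx in s1.
have [s2 s3|s2 _] := ltrP (Im s) 0; first by move: s2; rewrite -oppr_gt0 -ImN -s3 ltxx.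
have [u1|u1] := ltrP (Re u) 0; last by rewrite mulr_ge0.
by rewrite ReN mulrN -mulNr mulr_ge0 // oppr_ge0 ltW.
Qed.

Lemma sqrt_branch_prod u v :
  (sqrt_branch u - sqrt_branch v) * (sqrt_branch u + sqrt_branch v) = (u - v) * (u + v).
Proof. by rewrite -!subr_sqr !sqrt_branch_sqr; ring. Qed.

Lemma sqrt_branch_height u :
  let q := Im (sqrt_branch u) in 0 <= Im u ->
  (q ^+ 2 - Im u ^+ 2) * (q ^+ 2 + Re u ^+ 2) = q ^+ 2.
Proof.
move=> q y0; have := sqrt_branch_Re u; have := sqrt_branch_Im u; rewrite -/q.
set p := Re _; set x := Re u; set y := Im u => e1 e2.
have -> : q ^+ 2 = p ^+ 2 - (x ^+ 2 - y ^+ 2 - 1) by rewrite -e2; ring.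
have := congr1 (fun a => a ^+ 2) e1; rewrite /= !exprMn.
by have -> : q ^+ 2 = p ^+ 2 - (x ^+ 2 - y ^+ 2 - 1); [rewrite -e2; ring|nra].
Qed.

Lemma sqrt_branch_hyp_gt0 u : 0 <= Im u ->
  0 < Im (sqrt_branch u) ^+ 2 + Re u ^+ 2.
Proof.
move=> y0; rewrite lt_neqAle addr_ge0 ?sqr_ge0 // andbT; apply/negP => /eqP e.
have := sqrt_branch_Re u; have := sqr_ge0 (Im (sqrt_branch u)).
have := sqr_ge0 (Re u); have := sqr_ge0 (Re (sqrt_branch u)); have := sqr_ge0 (Im u).
move: e; set a := _ ^+ 2; set b := _ ^+ 2; nra.
Qed.

Lemma sqrt_branch_Im_sqr u : 0 <= Im u -> Im u ^+ 2 <= Im (sqrt_branch u) ^+ 2 <= Im u ^+ 2 + 1.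
Proof.
move=> y0; have := sqrt_branch_hyp_gt0 u y0; have /= := sqrt_branch_height u y0.
set q := _ ^+ 2; set x := _ ^+ 2; set y := _ ^+ 2 => e qx.
have q0 : 0 <= q by exact: sqr_ge0.
have x0 : 0 <= x by exact: sqr_ge0.
have y1 : 0 <= y by exact: sqr_ge0.
apply/andP; split.
  by rewrite -subr_ge0 -(pmulr_lge0 _ qx) e.
nra.
Qed.

Lemma sqrt_branch_Im_ge u : 0 <= Im u -> Im u <= Im (sqrt_branch u).
Proof.
move=> y0; have /andP[+ _] := sqrt_branch_Im_sqr u y0.
by rewrite ler_pXn2r ?nnegrE // sqrt_branch_Im_ge0.
Qed.

(** From [q^2 <= y^2 + 1] one gets [h^2 + 2 h y <= 1], hence [h <= 1] and [h y <= 1/2]. *)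
Lemma sqrt_branch_gain u : 0 <= Im u ->
  let h := Im (sqrt_branch u) - Im u in
  [/\ 0 <= h, h <= 1 & h * (1 + Im u) <= 3 / 2].
Proof.
move=> y0 h; have /andP[_ h1] := sqrt_branch_Im_sqr u y0.
have h0 : 0 <= h by rewrite subr_ge0 sqrt_branch_Im_ge.
have e : Im (sqrt_branch u) = h + Im u by rewrite /h; ring.
rewrite e in h1; split=> //; nra.
Qed.

(** The product of [v - u] and [v + u] is [-1], and [v - u] is the smaller factor in modulus, since
    the real parts of [u] and [v] agree in sign and both heights are nonnegative. *)
Lemma sqrt_branch_dist u : 0 <= Im u -> normc (sqrt_branch u - u) <= 1.
Proof.
move=> y0; have := sqrt_branch_ReM u y0; have := sqrt_branch_Im_ge u y0.
have : normc (sqrt_branch u - u) * normc (sqrt_branch u + u) = 1.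
  rewrite -Normc.normcM -subr_sqr sqrt_branch_sqr.
  by rewrite (_ : _ - _ = -1); [rewrite normcN Normc.normc1|ring].
move: (sqrt_branch u) => v e yq xp.
have l : normc (v - u) <= normc (v + u).
  apply: le_normc; rewrite ReB ImB ReD ImD; nra.
have := normc_ge0 (v - u); nra.
Qed.

End SqrtBranch.

(** * Moduli of continuity of the square root and of the maps [phi x] *)

Section Perturbation.
Context {R : rcfType}.
Implicit Types u v w z : R[i].

Lemma normc_distance u v : `|normc u - normc v| <= normc (u - v).
Proof.
have h1 := normcD (u - v) v; have h2 := normcD (v - u) u.
rewrite !subrK (normcB v u) in h1 h2.
by rewrite ler_norml; apply/andP; split; lra.
Qed.

Lemma sqrt_branch_sum_le u v : 0 <= Im u -> 0 <= Im v ->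
  normc (u + v) <= normc (sqrt_branch u + sqrt_branch v) + 2.
Proof.
move=> /sqrt_branch_dist hu /sqrt_branch_dist hv.
have -> : u + v = (sqrt_branch u + sqrt_branch v)
  + ((u - sqrt_branch u) + (v - sqrt_branch v)) by ring.
apply: le_trans (normcD _ _) _; rewrite lerD2l; apply: le_trans (normcD _ _) _.
by rewrite normcB (normcB v); lra.
Qed.

Lemma sqrt_branch_sum_ge (e : R) u v : 0 < e -> e <= Im u -> e <= Im v ->
  2 * e <= normc (sqrt_branch u + sqrt_branch v).
Proof.
move=> e0 eu ev; apply: le_trans (normc_Im _).
rewrite ImD ger0_norm ?addr_ge0 ?sqrt_branch_Im_ge0 //.
have := @sqrt_branch_Im_ge R u; have := @sqrt_branch_Im_ge R v; lra.
Qed.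

(** With roots [p], [q] of [u], [v]: [|p - q| |p + q| = |u - v| |u + v|], where
    [|u + v| <= |p + q| + 2] and [|p + q| >= 2 e]. *)
Lemma sqrt_branch_lip (e : R) u v : 0 < e -> e <= Im u -> e <= Im v ->
  normc (sqrt_branch u - sqrt_branch v) <= (1 + e^-1) * normc (u - v).
Proof.
move=> e0 eu ev; have b0 := sqrt_branch_sum_ge e u v e0 eu ev.
have a0 := sqrt_branch_sum_le u v ltac:(lra) ltac:(lra).
have /(congr1 (@Normc.normc R)) := sqrt_branch_prod u v; rewrite !Normc.normcM => E.
have d0 := normc_ge0 (u - v).
set b := normc (_ + _) in b0 a0 E.
have bp : 0 < b by lra.
rewrite -(ler_pM2r bp) E -mulrA [X in _ <= X]mulrCA ler_wpM2l //.
apply: le_trans a0 _; rewrite mulrDl mul1r lerD2l.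
by rewrite ler_pdivlMl // mulrC.
Qed.

Lemma sqrt_branch_ratio (e : R) u : 0 < e -> e <= Im u ->
  normc u / normc (sqrt_branch u) <= 1 + e^-1.
Proof.
move=> e0 eu; have b0 : e <= normc (sqrt_branch u).
  apply: le_trans (normc_Im _); rewrite ger0_norm ?sqrt_branch_Im_ge0 //.
  have := @sqrt_branch_Im_ge R u; lra.
have bp : 0 < normc (sqrt_branch u) by lra.
rewrite ler_pdivrMr // mulrDl mul1r.
have := normcD (u - sqrt_branch u) (sqrt_branch u); rewrite subrK normcB.
have := @sqrt_branch_dist R u ltac:(lra).
suff : 1 <= e^-1 * normc (sqrt_branch u) by lra.
by rewrite ler_pdivlMl ?mulr1.
Qed.

(* The derivative of [sqrt_branch] at [u] is [u / sqrt_branch u]. *)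
Lemma sqrt_branch_derivative (e : R) u v : 0 < e -> e <= 1 -> e <= Im u -> e <= Im v ->
  `|normc (sqrt_branch u - sqrt_branch v) - normc (u - v) * (normc u / normc (sqrt_branch u))|
  <= (1 + e^-1) ^+ 3 * normc (u - v) ^+ 2.
Proof.
move=> e0 e1 eu ev; have b0 := sqrt_branch_sum_ge e u v e0 eu ev.
have L := sqrt_branch_lip e u v e0 eu ev.
have Q := sqrt_branch_ratio e u e0 eu.
have E := sqrt_branch_prod u v.
have p0 : e <= normc (sqrt_branch u).
  apply: le_trans (normc_Im _); rewrite ger0_norm ?sqrt_branch_Im_ge0 //.
  have := @sqrt_branch_Im_ge R u; lra.
move: (sqrt_branch u) (sqrt_branch v) b0 L Q E p0 => p q b0 L Q E p0.
have pn : p != 0.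
  by apply/eqP => h; move: p0; rewrite h Normc.normc0; lra.
have bn : p + q != 0.
  by apply/eqP => h; move: b0; rewrite h Normc.normc0; lra.
have N1 : normc (u - v) * (normc u / normc p) = normc ((u - v) * (u / p)).
  by rewrite !Normc.normcM Normc.normcV.
have -> : normc (u - v) * (normc u / normc p) = normc ((u - v) * (u / p)) by [].
apply: le_trans (normc_distance _ _) _.
have D : p - q = (u - v) * (u + v) / (p + q) by rewrite -E mulfK.
(* Both factors are of order [u - v], the second one by the Lipschitz bound on [p - q]; so the error
   is quadratic. *)
have -> : p - q - (u - v) * (u / p) = (u - v) / (p + q) * (u / p * (p - q) - (u - v)).
  rewrite {1}D; field; by rewrite pn bn.
rewrite Normc.normcM Normc.normcM Normc.normcV.
set d := normc (u - v) in L *; set b := normc (p + q) in b0 *.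
have d0 : 0 <= d by exact: normc_ge0.
have bi : b^-1 <= (1 + e^-1) / 2.
  rewrite -[leRHS]invrK lef_pV2 ?posrE; last 2 first.
  - lra.
  - by rewrite invr_gt0 divr_gt0 // addr_gt0 // invr_gt0.
  apply: le_trans b0; rewrite invf_div ler_pdivrMr ?addr_gt0 ?invr_gt0 //.
  rewrite mulrDr mulr1 -mulrA divff ?mulr1; lra.
set K := 1 + e^-1 in L Q bi *.
have K1 : 1 <= e^-1 by rewrite invf_ge1.
have K2 : 2 <= K by rewrite /K; lra.
have M : normc (u / p * (p - q) - (u - v)) <= K * K * d + d.
  apply: le_trans (normcD _ _) _; rewrite normcN lerD2r Normc.normcM -mulrA.
  apply: ler_pM; rewrite ?normc_ge0 //.
  by rewrite Normc.normcM Normc.normcV.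
have bi0 : 0 <= b^-1 by rewrite invr_ge0; lra.
apply: (@le_trans _ _ (d * (K / 2) * (K * K * d + d))).
  apply: ler_pM; rewrite ?normc_ge0 ?mulr_ge0 // ler_wpM2l //.
have : 0 <= d ^+ 2 * (K * (K * K - 1)).
  apply: mulr_ge0; first exact: sqr_ge0.
  nra.
nra.
Qed.

(** When the real parts of the roots agree in sign, [|p - q| <= |p + q|], so [|p - q|^2] is at most
    [|u - v| |u + v|]. *)
Lemma sqrt_branch_holder_half u v : 0 <= Im u -> 0 <= Im v -> normc (u - v) <= 1 ->
  0 <= Re (sqrt_branch u) * Re (sqrt_branch v) ->
  normc (sqrt_branch u - sqrt_branch v) ^+ 2 <= 4 * normc (u - v).
Proof.
move=> u0 v0 d1 pp; have a0 := sqrt_branch_sum_le u v u0 v0.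
have qu := sqrt_branch_Im_ge0 u; have qv := sqrt_branch_Im_ge0 v.
have /(congr1 (@Normc.normc R)) := sqrt_branch_prod u v; rewrite !Normc.normcM.
move: (sqrt_branch u) (sqrt_branch v) a0 qu qv pp => p q a0 qu qv pp E.
have gb : normc (p - q) <= normc (p + q).
  apply: le_normc; rewrite ReB ImB ReD ImD; nra.
have d0 := normc_ge0 (u - v); have g0 := normc_ge0 (p - q).
move: (normc (p - q)) (normc (p + q)) (normc (u - v)) (normc (u + v)) E a0 gb d0 g0 d1.
move=> g b d a E a0 gb d0 g0 d1.
have E2 : g * b <= d * (b + 2) by rewrite E ler_wpM2l.
have [b2|b2] := lerP b 2; first by nra.
have g2 : g <= 2 * d by nra.
nra.
Qed.

Lemma sqrt_branch_holder u v : 0 <= Im u -> 0 <= Im v -> normc (u - v) <= 1 ->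
  normc (sqrt_branch u - sqrt_branch v) <= 4 * Num.sqrt (normc (u - v)).
Proof.
move=> u0 v0 d1.
have half w z : 0 <= Im w -> 0 <= Im z -> normc (w - z) <= normc (u - v) ->
    0 <= Re (sqrt_branch w) * Re (sqrt_branch z) ->
    normc (sqrt_branch w - sqrt_branch z) <= 2 * Num.sqrt (normc (u - v)).
  move=> w0 z0 d2 pp.
  rewrite -(@ler_pXn2r _ 2) ?nnegrE ?normc_ge0 ?mulr_ge0 ?sqrtr_ge0 //.
  rewrite exprMn sqr_sqrtr ?normc_ge0 //.
  have := sqrt_branch_holder_half w z w0 z0 (le_trans d2 d1) pp; lra.
have s0 := sqrtr_ge0 (normc (u - v)).
have pu := sqrt_branch_ReM u u0; have pv := sqrt_branch_ReM v v0.
have [x0|x0] := ltrP 0 (Re u * Re v).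
  have : 0 <= Re (sqrt_branch u) * Re (sqrt_branch v) by nra.
  move=> /(half u v u0 v0 (lexx _)); lra.
(* The segment from [u] to [v] meets the imaginary axis at parameter [t]; there the root has real
   part 0, so the previous lemma applies on both sides. If the real parts are equal they vanish, and
   division by zero gives [t = 0]. *)
pose t := Re u / (Re u - Re v).
have t01 : 0 <= t <= 1.
  rewrite /t; have [xe|xe] := eqVneq (Re u) (Re v).
    by rewrite xe subrr invr0 mulr0 lexx ler01.
  have [xp|xp] := ltrP 0 (Re u - Re v).
    by rewrite ler_pdivlMr // ler_pdivrMr // mul0r mul1r; apply/andP; split; nra.
  have xn : Re u - Re v < 0 by rewrite lt_neqAle xp andbT subr_eq0.
  by rewrite ler_ndivlMr // ler_ndivrMr // mul0r mul1r; apply/andP; split; nra.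
have tx : Re u = t * (Re u - Re v).
  rewrite /t; have [xe|xe] := eqVneq (Re u - Re v) 0; last by rewrite divfK.
  by rewrite xe mulr0; nra.
clearbody t.
pose m : R[i] := 0 +i* (Im u + t * (Im v - Im u)).
have m0 : 0 <= Im m by rewrite /m /=; case/andP: t01 => t0 t1; nra.
have pm : Re (sqrt_branch m) = 0.
  have := sqrt_branch_Im m; rewrite /m /= mul0r => /eqP; rewrite mulf_eq0.
  case/orP => /eqP // q0; have := @sqrt_branch_hyp_gt0 R m m0.
  by rewrite q0 /m /= expr0n /= addr0 ltxx.
have d2 : normc (u - m) <= normc (u - v).
  apply: le_normc; rewrite !ReB !ImB /m /= subr0 {1}tx.
  have -> : Im u - (Im u + t * (Im v - Im u)) = t * (Im u - Im v) by ring.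
  case/andP: t01 => t0 t1.
  by rewrite !exprMn -mulrDr; apply: ler_piMl; rewrite ?addr_ge0 ?sqr_ge0 //; nra.
have d3 : normc (m - v) <= normc (u - v).
  apply: le_normc; rewrite !ReB !ImB /m /= sub0r.
  have nv : - Re v = (1 - t) * (Re u - Re v) by rewrite mulrBl mul1r -tx; ring.
  rewrite {1}nv.
  have -> : Im u + t * (Im v - Im u) - Im v = (1 - t) * (Im u - Im v) by ring.
  case/andP: t01 => t0 t1.
  by rewrite !exprMn -mulrDr; apply: ler_piMl; rewrite ?addr_ge0 ?sqr_ge0 //; nra.
have h1 := half u m u0 m0 d2 ltac:(by rewrite pm mulr0).
have h2 := half m v m0 v0 d3 ltac:(by rewrite pm mul0r).
have := normcD (sqrt_branch u - sqrt_branch m) (sqrt_branch m - sqrt_branch v).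
rewrite addrA subrK; lra.
Qed.

Lemma phiE x z : phi x z = x%:C + sqrt_branch (z - x%:C).
Proof. by []. Qed.

Lemma Im_phi x z : Im (phi x z) = Im (sqrt_branch (z - x%:C)).
Proof. by rewrite phiE ImD /= add0r. Qed.

Lemma Im_phi_ge x z : 0 <= Im z -> Im z <= Im (phi x z).
Proof.
have e : Im (z - x%:C) = Im z by rewrite ImB /= subr0.
by rewrite Im_phi -{1 2}e; exact: sqrt_branch_Im_ge.
Qed.

Lemma normcR (x : R) : normc x%:C = `|x|.
Proof. by rewrite /= expr0n addr0 sqrtr_sqr. Qed.

Lemma phi_continuous (eta : R) : 0 < eta -> exists2 d, 0 < d <= eta &
  forall x x' z z', 0 <= Im z -> 0 <= Im z' -> `|x - x'| <= d -> normc (z - z') <= d ->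
  normc (phi x z - phi x' z') <= eta.
Proof.
(* The bound [1/2] keeps the arguments within distance 1, [eta / 2] pays for the outer shift by [x],
   and [eta^2 / 128] makes the Hölder term at most [eta / 2]. *)
move=> eta0; exists (Num.min (1 / 2) (Num.min (eta / 2) (eta ^+ 2 / 128))).
  rewrite !lt_min !divr_gt0 //=; last by rewrite exprn_gt0.
  by rewrite !ge_min; apply/orP; right; apply/orP; left; lra.
move=> x x' z z' z0 z'0; rewrite !le_min => /and3P[x1 x2 x3] /and3P[d1 d2 d3].
have D : normc ((z - x%:C) - (z' - x'%:C)) <= `|x - x'| + normc (z - z').
  rewrite (_ : _ - _ - _ = (x' - x)%:C + (z - z')); last by rewrite rmorphB /=; ring.
  by apply: le_trans (normcD _ _) _; rewrite normcR distrC.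
have H := sqrt_branch_holder (z - x%:C) (z' - x'%:C)
  ltac:(by rewrite ImB /= subr0) ltac:(by rewrite ImB /= subr0) ltac:(lra).
rewrite !phiE (_ : _ - _ = (x - x')%:C + (sqrt_branch (z - x%:C) - sqrt_branch (z' - x'%:C)));
  last by rewrite rmorphB /=; ring.
apply: le_trans (normcD _ _) _; rewrite normcR.
suff : 4 * Num.sqrt (normc (z - x%:C - (z' - x'%:C))) <= eta / 2 by lra.
rewrite -(@ler_pXn2r _ 2) ?nnegrE ?mulr_ge0 ?sqrtr_ge0 //; last by lra.
rewrite exprMn sqr_sqrtr ?normc_ge0 // exprMn; lra.
Qed.

(** Compares the maps at the true positions [p.1], started on the real axis, with those at the grid
    positions [p.2], started slightly above it. The tolerance depends on the number of maps only. *)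
Lemma foldl_phi_continuous (n : nat) (eta : R) : 0 < eta -> exists2 d, 0 < d <= eta &
  forall (l : seq (R * R)) z z', (size l <= n)%N -> all (fun p => `|p.1 - p.2| <= d) l ->
  0 <= Im z -> 0 <= Im z' -> normc (z - z') <= d ->
  normc (foldl (fun w p => phi p.1 w) z l - foldl (fun w p => phi p.2 w) z' l) <= eta.
Proof.
elim: n eta => [|n IH] eta eta0.
  by exists eta; rewrite ?eta0 ?lexx //; case.
have [d /andP[d0 de] Hd] := IH _ eta0; have [d' /andP[d'0 d'd] Hd'] := phi_continuous d d0.
exists d'; first by rewrite d'0 (le_trans d'd).
move=> [|p l] z z' /= s; first by move=> _ _ _ h; apply: le_trans de; apply: le_trans d'd.
move=> /andP[p1 /allP al] z0 z'0 zz; apply: Hd => //.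
- by apply/allP => q /al h; apply: le_trans d'd.
- by apply: le_trans (Im_phi_ge _ _ _).
- by apply: le_trans (Im_phi_ge _ _ _).
- exact: Hd'.
Qed.

End Perturbation.

(** * The Lyapunov function *)

Section Lyapunov.
Context {R : realType}.
Implicit Types h y s : R.

(* The polynomial factor compensates the second-order term of [expR (4 * h)] and
   the stretching of distances, both of order [h / (1 + y)] for large [y]. *)
Definition lyap (a : nat) (y : R) : R := expR (4 * y) / (1 + y) ^+ a.

Lemma lyap_gt0 a y : 0 <= y -> 0 < lyap a y.
Proof. by move=> y0; rewrite divr_gt0 ?expR_gt0 // exprn_gt0 //; lra. Qed.

Lemma bernoulli_le (n : nat) (s : R) : 0 <= s -> 1 + n%:R * s <= (1 + s) ^+ n.
Proof.
move=> s0; elim: n => [|n IH]; first by rewrite expr0 mul0r addr0.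
rewrite exprS; have n0 : 0 <= n%:R * s by rewrite mulr_ge0.
rewrite -natr1; nra.
Qed.

(** Squaring [(1 - h/2) * expR (h/2) <= 1] bounds [expR h] by a rational function. *)
Lemma expR_quadratic h : 0 <= h <= 1 -> expR h <= 1 + h + 3 * h ^+ 2.
Proof.
case/andP => h0 h1; have := expR_ge1Dx (- (h / 2)); rewrite expRN => e.
have e0 := expR_gt0 (h / 2).
have e1 : (1 - h / 2) * expR (h / 2) <= 1.
  by rewrite -ler_pdivlMr // div1r.
have -> : expR h = expR (h / 2) ^+ 2 by rewrite expr2 -expRD; congr expR; lra.
have e2 : ((1 - h / 2) * expR (h / 2)) ^+ 2 <= 1.
  by rewrite exprn_ile1 // mulr_ge0 ?expR_ge0 //; lra.
rewrite exprMn in e2; move: (expR _ ^+ 2) (sqr_ge0 (expR (h / 2))) e2 => E E0 e2.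
have p : 1 <= (1 - h / 2) ^+ 2 * (1 + h + 3 * h ^+ 2).
  have -> : (1 - h / 2) ^+ 2 * (1 + h + 3 * h ^+ 2)
    = 1 + h ^+ 2 * (9 / 4 - 11 / 4 * h + 3 / 4 * h ^+ 2) by field.
  rewrite lerDl mulr_ge0 ?sqr_ge0 //; nra.
have c0 : 0 < (1 - h / 2) ^+ 2 by rewrite exprn_gt0 //; lra.
by rewrite -(ler_pM2l c0) (le_trans e2).
Qed.

(** Here [s] stands for [h / (1 + y)], and the hypothesis on [h^2] is [h (1 + y) <= 3/2]. The
    exponent 196 absorbs the quadratic term and leaves four powers out of 200 for the stretching. *)
Lemma expR4_le_linear h s : 0 <= h <= 1 -> h ^+ 2 <= 3 / 2 * s ->
  expR (4 * h) <= (1 + 4 * h) * (1 + s) ^+ 196.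
Proof.
move=> /[dup] /expR_quadratic E /andP[h0 h1] hs.
have s0 : 0 <= s by have := sqr_ge0 h; lra.
have -> : expR (4 * h) = expR h ^+ 4 by rewrite expRM_natl.
have B := bernoulli_le 196 s s0.
apply: (@le_trans _ _ ((1 + h + 3 * h ^+ 2) ^+ 4)).
  by rewrite lerXn2r ?nnegrE ?expR_ge0 //; nra.
apply: (@le_trans _ _ ((1 + 4 * h) * (1 + 196%:R * s))); last by rewrite ler_wpM2l //; lra.
apply: (@le_trans _ _ ((1 + 4 * h) * (1 + 130 * h ^+ 2))); last first.
  by rewrite ler_wpM2l //; lra.
rewrite -subr_ge0.
have -> : (1 + 4 * h) * (1 + 130 * h ^+ 2) - (1 + h + 3 * h ^+ 2) ^+ 4
  = h ^+ 2 * (112 + 480 * h - 91 * h ^+ 2 - 120 * h ^+ 3 - 162 * h ^+ 4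
              - 108 * h ^+ 5 - 81 * h ^+ 6) by ring.
have X n : h ^+ n.+1 <= h by rewrite exprS ler_piMr // exprn_ile1.
apply: mulr_ge0; first exact: sqr_ge0.
have := X 1%N; have := X 2%N; have := X 3%N; have := X 4%N; have := X 5%N; lra.
Qed.

(** For [y <= 1] one has [h <= 2 s] with [s = h / (1 + y)], and the polynomial factor alone
    dominates the exponential. *)
Lemma expR4_le_power h s : 0 <= h <= 1 -> h <= 2 * s -> expR (4 * h) <= (1 + s) ^+ 32.
Proof.
move=> /[dup] /expR_quadratic E /andP[h0 h1] hs.
have s0 : 0 <= s by lra.
have -> : expR (4 * h) = expR h ^+ 4 by rewrite expRM_natl.
have -> : (1 + s) ^+ 32 = ((1 + s) ^+ 8) ^+ 4 by rewrite -exprM.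
rewrite lerXn2r ?nnegrE ?expR_ge0 ?exprn_ge0 //; first by lra.
by apply: le_trans (bernoulli_le 8 s s0); nra.
Qed.

Context (a : nat) (a200 : (200 <= a)%N).

Lemma lyapD h y : 0 <= h -> 0 <= y ->
  lyap a (y + h) = lyap a y * (expR (4 * h) / (1 + h / (1 + y)) ^+ a).
Proof.
move=> h0 y0; rewrite /lyap mulrDr expRD.
have -> : 1 + (y + h) = (1 + y) * (1 + h / (1 + y)) by field; lra.
by rewrite exprMn invfM; ring.
Qed.

(** Reduces the one-step estimates to the exponent 200: the base is at least 1 and [a >= 200]. *)
Lemma lyapD_le h y c : 0 <= h -> 0 <= y -> expR (4 * h) * c <= (1 + h / (1 + y)) ^+ 200 ->
  0 <= c -> lyap a (y + h) * c <= lyap a y.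
Proof.
move=> h0 y0 E c0; rewrite lyapD // -mulrA ler_piMr ?(ltW (lyap_gt0 _ _ y0)) //.
have s0 : 0 <= h / (1 + y) by rewrite divr_ge0 //; lra.
rewrite mulrAC ler_pdivrMr ?mul1r; last by rewrite exprn_gt0 //; lra.
by apply: le_trans E _; rewrite ler_weXn2l //; lra.
Qed.

Lemma lyap_step h y : 0 <= h <= 1 -> 0 <= y -> h * (1 + y) <= 3 / 2 ->
  lyap a (y + h) <= (1 + 4 * h) * lyap a y.
Proof.
move=> /[dup] h01 /andP[h0 h1] y0 hy.
have c0 : 0 < 1 + 4 * h by lra.
rewrite -ler_pdivrMl // [leLHS]mulrC; apply: lyapD_le => //; last by rewrite invr_ge0 ltW.
have s0 : 0 <= h / (1 + y) by rewrite divr_ge0 //; lra.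
rewrite ler_pdivrMr // [leRHS]mulrC.
apply: le_trans (expR4_le_linear h (h / (1 + y)) h01 _) _.
  by rewrite mulrA ler_pdivlMr; nra.
by rewrite ler_wpM2l ?(ltW c0) // ler_weXn2l //; lra.
Qed.

(** The factor [c], later the stretching, is at most [1 + 4 s <= (1 + s)^4], which uses the four
    remaining powers. *)
Lemma lyap_step_high h y c : 0 <= h <= 1 -> 0 <= y -> h * (1 + y) <= 3 / 2 ->
  0 <= c <= 1 + 4 * (h / (1 + y)) -> lyap a (y + h) * c <= (1 + 4 * h) * lyap a y.
Proof.
move=> /[dup] h01 /andP[h0 h1] y0 hy /andP[c0 c1].
have d0 : 0 < 1 + 4 * h by lra.
rewrite -ler_pdivrMl // [leLHS]mulrC -mulrA; apply: lyapD_le => //; last first.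
  by rewrite divr_ge0 // ltW.
have s0 : 0 <= h / (1 + y) by rewrite divr_ge0 //; lra.
rewrite mulrA ler_pdivrMr //.
have E := expR4_le_linear h (h / (1 + y)) h01 ltac:(by rewrite mulrA ler_pdivlMr; nra).
have B := bernoulli_le 4 _ s0.
have -> : (1 + h / (1 + y)) ^+ 200 * (1 + 4 * h)
  = (1 + 4 * h) * (1 + h / (1 + y)) ^+ 196 * (1 + h / (1 + y)) ^+ 4.
  by rewrite mulrC -mulrA -exprD.
by apply: ler_pM => //; exact: le_trans c1 _.
Qed.

Lemma lyap_step_low h y : 0 <= h <= 1 -> 0 <= y <= 1 -> lyap a (y + h) <= lyap a y.
Proof.
move=> h01 /andP[y0 y1]; case/andP: (h01) => h0 h1.
have s0 : 0 <= h / (1 + y) by rewrite divr_ge0 //; lra.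
rewrite -[leLHS]mulr1; apply: lyapD_le => //; rewrite mulr1.
apply: le_trans (expR4_le_power h (h / (1 + y)) h01 _) _.
  by rewrite mulrA ler_pdivlMr; nra.
by rewrite ler_weXn2l //; lra.
Qed.

(** The logarithmic derivative [4 - a / (1 + y)] is at most [4 + a] in modulus. *)
Lemma lyap_loglip y z : 0 <= y -> 0 <= z ->
  lyap a z <= lyap a y * expR ((4 + a%:R) * `|z - y|).
Proof.
move=> y0 z0; have [yz|zy] := lerP y z.
  rewrite -{1}[z](subrKC y) lyapD ?subr_ge0 //.
  rewrite ler_wpM2l ?(ltW (lyap_gt0 _ _ y0)) // (mulrDl 4) expRD.
  have s0 : 0 <= (z - y) / (1 + y) by rewrite divr_ge0 //; lra.
  rewrite ler_wpM2l ?expR_ge0 //.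
  apply: (@le_trans _ _ 1); first by rewrite invf_le1 ?exprn_gt0 ?exprn_ege1 //; lra.
  by rewrite -expR0 ler_expR mulr_ge0 //; lra.
rewrite -{1}[y](subrKC z) lyapD ?subr_ge0 ?(ltW zy) //.
rewrite -mulrA ler_peMr ?(ltW (lyap_gt0 _ _ z0)) // (mulrDl 4) expRD mulrAC.
set s := (y - z) / (1 + z).
have s0 : 0 <= s by rewrite divr_ge0 //; lra.
rewrite ler_pdivlMr ?mul1r ?exprn_gt0 //; last by lra.
rewrite -[leLHS]mul1r; apply: ler_pM; rewrite ?exprn_ge0 //; first by lra.
  by apply: le_trans (expR_ge1Dx _); lra.
rewrite -[leLHS]mul1r; apply: ler_pM; rewrite ?exprn_ge0 //; first by lra.
  by apply: le_trans (expR_ge1Dx _); lra.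
rewrite expRM_natl lerXn2r ?nnegrE ?expR_ge0 //; first by lra.
apply: le_trans (expR_ge1Dx _) _; rewrite ler_expR /s ler_pdivrMr; nra.
Qed.

(** The hypothesis on [a] says that [4 - a / (1 + y)], the logarithmic derivative, is nonnegative
    from [y] on. *)
Lemma lyap_mono y z : 0 <= y -> a%:R <= 4 * (1 + y) -> y <= z -> lyap a y <= lyap a z.
Proof.
move=> y0 ay yz; rewrite -[z](subrKC y) lyapD ?subr_ge0 //.
rewrite ler_peMr ?(ltW (lyap_gt0 _ _ y0)) //.
set s := (z - y) / (1 + y).
have s0 : 0 <= s by rewrite divr_ge0 //; lra.
rewrite ler_pdivlMr ?mul1r ?exprn_gt0 //; last by lra.
apply: (@le_trans _ _ (expR s ^+ a)).
  by rewrite lerXn2r ?nnegrE ?expR_ge0 ?expR_ge1Dx //; lra.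
rewrite -expRM_natl ler_expR /s mulrA ler_pdivrMr; nra.
Qed.

End Lyapunov.

(** * Integrals of the gain in height and of the stretching *)

Section RiemannSums.
Context {R : realType}.
Implicit Types x y e d : R.

Lemma sin_le_id x : 0 <= x -> sin x <= x.
Proof.
move=> x0; have [|c _ E] := @MVT_segment R sin cos 0 x x0 (fun z _ => is_derive_sin z).
  by apply: continuous_subspaceT => z; exact: continuous_sin.
move: E; rewrite sin0 !subr0 => ->.
by rewrite ler_piMl // cos_le1.
Qed.

(** With [t = atan x] the second term is [sin (2 t) / 2], and [sin (pi - 2 t) <= pi - 2 t]. *)
Lemma atan_complement x : 0 <= x -> atan x + x / (1 + x ^+ 2) <= pi / 2.
Proof.
move=> x0; set t := atan x.
have t1 : t < pi / 2 := atan_ltpi2 x.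
have s0 : 0 < 1 + x ^+ 2 by have := sqr_ge0 x; lra.
have c : cos t = (Num.sqrt (1 + x ^+ 2))^-1 by exact: cos_atan.
have cn : cos t != 0 by rewrite c invr_eq0 sqrtr_eq0 -ltNge.
have s : sin t = x * cos t by rewrite -{1}(atanK x) /tan divfK.
have e : x / (1 + x ^+ 2) = cos t * sin t.
  by rewrite s mulrCA -expr2 c exprVn sqr_sqrtr // ltW.
have : sin (pi - t *+ 2) <= pi - t *+ 2 by apply: sin_le_id; lra.
rewrite sinB sinpi cospi mul0r sub0r mulN1r opprK sin_mulr2n -e; lra.
Qed.

(** A closed formula without case distinctions, from which differentiability in [x] is read off. *)
Lemma sqrt_branch_Im_explicit x y : 0 <= y ->
  Im (sqrt_branch (x +i* y)) =
  Num.sqrt ((Num.sqrt ((x ^+ 2 - y ^+ 2 - 1) ^+ 2 + 4 * (x ^+ 2 * y ^+ 2))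
             - (x ^+ 2 - y ^+ 2 - 1)) / 2).
Proof.
move=> y0; have := sqrt_branch_Re (x +i* y); have := sqrt_branch_Im (x +i* y) => /=.
have := sqrt_branch_Im_ge0 (x +i* y); move: (sqrt_branch _) => [p q] /= q0 e1 e2.
have -> : (x ^+ 2 - y ^+ 2 - 1) ^+ 2 + 4 * (x ^+ 2 * y ^+ 2) = (p ^+ 2 + q ^+ 2) ^+ 2.
  by rewrite -e2 -exprMn -e1; ring.
rewrite sqrtr_sqr ger0_norm ?addr_ge0 ?sqr_ge0 // -e2.
have -> : (p ^+ 2 + q ^+ 2 - (p ^+ 2 - q ^+ 2)) / 2 = q ^+ 2 by field.
by rewrite sqrtr_sqr ger0_norm.
Qed.

Lemma sqrt_branch_Im_derivable x y : 0 < y ->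
  derivable (fun x => Im (sqrt_branch (x +i* y))) x 1.
Proof.
move=> y0.
have -> : (fun x => Im (sqrt_branch (x +i* y))) = Num.sqrt \o (fun x =>
  2^-1 * ((Num.sqrt \o (fun x => (x ^+ 2 - y ^+ 2 - 1) ^+ 2 + 4 * (x ^+ 2 * y ^+ 2))) x
             - (x ^+ 2 - y ^+ 2 - 1))).
  by apply/funext => z; rewrite sqrt_branch_Im_explicit ?ltW //= mulrC.
set g := (fun x => _ + 4 * _).
(* The inner radicand stays positive: at [x = 0] by its first square, elsewhere by [x^2 y^2]. *)
have g0 : 0 < g x.
  rewrite /g; have [->|xn] := eqVneq x 0.
    by have := sqr_ge0 y; rewrite expr0n /=; nra.
  rewrite ltr_wpDl ?sqr_ge0 //; apply: mulr_gt0 => //; apply: mulr_gt0; rewrite exprn_even_gt0 //=.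
  by rewrite gt_eqF.
have gd : derivable g x 1 by [].
have sg : derivable (Num.sqrt \o g) x 1.
  apply/derivable1_diffP; apply: differentiable_comp; first exact/derivable1_diffP.
  by apply/derivable1_diffP; case: (is_derive1_sqrt g0).
have pd : derivable (fun x => x ^+ 2 - y ^+ 2 - 1 : R) x 1.
  apply: derivableB; last exact: derivable_cst.
  by apply: derivableB; [exact: exprn_derivable|exact: derivable_cst].
have cd : derivable (fun=> 2^-1 : R) x 1 by exact: derivable_cst.
apply/derivable1_diffP; apply: differentiable_comp.
  exact/derivable1_diffP/(derivableM cd)/(derivableB sg pd).
apply/derivable1_diffP.
set w := 2^-1 * _; have w0 : 0 < w.
  have : 0 < Im (sqrt_branch (x +i* y)).
    by apply: lt_le_trans (sqrt_branch_Im_ge _ _); rewrite //= ltW.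
  by rewrite sqrt_branch_Im_explicit ?(ltW y0) // sqrtr_gt0 mulrC.
by case: (is_derive1_sqrt w0).
Qed.

(* With [r = x / q] the height identity reads [q^2 - y^2 = 1 / (1 + r^2)], and
   integrating [q - y] by layers gives this primitive of [x |-> q - y]. *)
Definition gain_primitive y x : R :=
  let q := Im (sqrt_branch (x +i* y)) in
  x * (q - y) + (atan (x / q) - (x / q) * (q ^+ 2 - y ^+ 2)) / 2.

(** The derivative of [q] is not computed explicitly: differentiating both sides of
    [q^2 - y^2 = 1 / (1 + r^2)] expresses it through that of [r], and the terms with [r'] cancel. *)
Lemma is_derive_gain_primitive x y : 0 < y ->
  is_derive x 1 (gain_primitive y) (Im (sqrt_branch (x +i* y)) - y).
Proof.
move=> y0; set Q := fun x => Im (sqrt_branch (x +i* y)).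
have Qd := sqrt_branch_Im_derivable x y y0.
have Q0 z : 0 < Q z.
  by apply: lt_le_trans (sqrt_branch_Im_ge _ _); rewrite //= ltW.
set q' := 'D_1 Q x; have dQ : is_derive x 1 Q q' by split.
have Qn : Q x != 0 by rewrite gt_eqF.
have Hid z : Q z ^+ 2 - y ^+ 2 = (1 + (z * (Q z)^-1) ^+ 2)^-1.
  have := sqrt_branch_height (z +i* y) (ltW y0); rewrite /= -/(Q z) => E.
  have Qz : Q z != 0 by rewrite gt_eqF.
  have sn : Q z ^+ 2 + z ^+ 2 != 0.
    by rewrite gt_eqF // ltr_pwDl ?sqr_ge0 // exprn_gt0.
  rewrite exprMn exprVn; apply: (mulIf sn); rewrite E; field.
  by rewrite sn Qz.
pose r z := z * (Q z)^-1.
have dr : is_derive x 1 r (x *: (- (Q x) ^- 2 *: q') + (Q x)^-1 *: 1).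
  by apply: is_deriveM.
set r' := _ + _ in dr.
have r'E : r' = (Q x - x * q') / Q x ^+ 2.
  by rewrite /r' /GRing.scale /=; field.
have dat : is_derive x 1 (atan \o r) (r' * (1 + r x ^+ 2)^-1).
  have := @is_derive1_comp _ atan r x _ _ (is_derive1_atan (r x)) dr.
  by rewrite mulrC.
have sn : 1 + r x ^+ 2 != 0 by rewrite gt_eqF // ltr_pwDl ?sqr_ge0.
have dQ2 : is_derive x 1 (fun z => Q z ^+ 2 - y ^+ 2) (2 * Q x * q').
  apply: is_derive_eq.
  by rewrite /GRing.scale /= subr0; ring.
have dQ3 : is_derive x 1 (fun z => Q z ^+ 2 - y ^+ 2) (- (2 * r x * r') / (1 + r x ^+ 2) ^+ 2).
  have -> : (fun z => Q z ^+ 2 - y ^+ 2) = (fun z => (1 + r z ^+ 2)^-1).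
    by apply/funext => z; exact: Hid.
  have d1 : is_derive x 1 (fun z => 1 + r z ^+ 2) (2 * r x * r').
    apply: is_derive_eq.
    by rewrite /GRing.scale /= add0r; ring.
  have d2 := @is_deriveV _ (fun z => 1 + r z ^+ 2) x _ _ sn d1.
  apply: is_derive_eq.
  by rewrite /GRing.scale /=; field.
have key : 2 * Q x * q' = - (2 * r x * r') / (1 + r x ^+ 2) ^+ 2.
  by rewrite -(@derive_val _ _ _ _ _ _ _ dQ2) (@derive_val _ _ _ _ _ _ _ dQ3).
have -> : gain_primitive y = (fun z => z * (Q z - y) + ((atan \o r) z - r z * (Q z ^+ 2 - y ^+ 2)) * 2^-1).
  by [].
apply: is_derive_eq; rewrite /GRing.scale /=.
have Hx : Q x ^+ 2 - y ^+ 2 = (1 + r x ^+ 2)^-1 := Hid x.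
have xq : x * q' = - (r x ^+ 2 * r' / (1 + r x ^+ 2) ^+ 2).
  have xr : x = r x * Q x by rewrite /r divfK.
  have h : Q x * q' = - (r x * r') / (1 + r x ^+ 2) ^+ 2.
    apply: (@mulfI _ 2) => //; rewrite mulrA key; field; exact: sn.
  by rewrite {1}xr -mulrA h; field; exact: sn.
rewrite subr0 xq Hx -/(Q x).
by field; exact: sn.
Qed.

(** With [r = x / q >= 0], [B = r / (1 + r^2)] and [c = q / (q + y)], the primitive is
    [c B + (atan r - B) / 2]. Since [1/2 <= c <= 1], it lies between 0 and [(atan r + B) / 2];
    negative [r] follows by oddness. *)
Lemma gain_primitive_bound x y : 0 < y -> `|gain_primitive y x| <= pi / 4.
Proof.
move=> y0; have q0 : 0 < Im (sqrt_branch (x +i* y)).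
  by apply: lt_le_trans (sqrt_branch_Im_ge _ _); rewrite //= ltW.
have := sqrt_branch_height (x +i* y) (ltW y0); rewrite /gain_primitive /=.
set q := Im _ in q0 * => E.
have sn : 0 < q ^+ 2 + x ^+ 2 by rewrite ltr_pwDl ?sqr_ge0 // exprn_gt0.
have qy : y <= q by apply: (@sqrt_branch_Im_ge R (x +i* y)) => /=; exact: ltW.
clearbody q.
have e : q ^+ 2 - y ^+ 2 = q ^+ 2 / (q ^+ 2 + x ^+ 2).
  by rewrite -{2}E mulfK // gt_eqF.
set r := x / q.
have xr : x = r * q by rewrite /r divfK // gt_eqF.
have rn : 1 + r ^+ 2 != 0 by rewrite gt_eqF // ltr_pwDl ?sqr_ge0.
have e2 : q ^+ 2 - y ^+ 2 = (1 + r ^+ 2)^-1.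
  rewrite e xr; field; rewrite rn gt_eqF //=; last first.
  by move: sn; rewrite xr.
set c := q / (q + y).
have c01 : 1 / 2 <= c <= 1 by rewrite /c ler_pdivlMr ?ler_pdivrMr; [apply/andP; split; lra|lra|lra].
have e3 : x * (q - y) = c * (r / (1 + r ^+ 2)).
  rewrite -e2 subr_sqr /c {1}xr; field; lra.
rewrite e3 e2 -[r * _]/(r / (1 + r ^+ 2)).
have bound s : 0 <= s -> 0 <= c * (s / (1 + s ^+ 2)) + (atan s - s / (1 + s ^+ 2)) / 2 <= pi / 4.
  move=> s0; have := atan_complement s s0.
  have : 0 <= s / (1 + s ^+ 2) by rewrite divr_ge0 // addr_ge0 // sqr_ge0.
  have : 0 <= atan s by rewrite -(@atan0 R) le_atan.
  move: (atan s) (s / _) => A B A0 B0 H; case/andP: c01 => c0 c1.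
  by apply/andP; split; nra.
have [r0|r0] := lerP 0 r.
  by have /andP[b1 b2] := bound r r0; rewrite ger0_norm.
have /andP[] := bound (- r) ltac:(lra); rewrite sqrrN atanN mulNr => b1 b2.
by rewrite ler_norml; apply/andP; split; lra.
Qed.

Lemma sqrt_branch_Im_anti y x1 x2 : 0 < y -> x1 ^+ 2 <= x2 ^+ 2 ->
  Im (sqrt_branch (x2 +i* y)) <= Im (sqrt_branch (x1 +i* y)).
Proof.
move=> y0 x12; rewrite leNgt; apply/negP => lt12.
have /= E1 := sqrt_branch_height (x1 +i* y) (ltW y0).
have /= E2 := sqrt_branch_height (x2 +i* y) (ltW y0).
have := sqrt_branch_Im_ge (x1 +i* y) (ltW y0); rewrite /= => y1.
move: (Im (sqrt_branch (x1 +i* y))) (Im (sqrt_branch (x2 +i* y))) E1 E2 lt12 y1.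
move=> q1 q2 E1 E2 lt12 y1.
have A12 : q1 ^+ 2 < q2 ^+ 2 by nra.
have yA : y ^+ 2 <= q1 ^+ 2 by nra.
have Y0 : 0 < y ^+ 2 by nra.
have X1 := sqr_ge0 x1.
move: (q1 ^+ 2) (q2 ^+ 2) (y ^+ 2) (x1 ^+ 2) (x2 ^+ 2) E1 E2 A12 yA Y0 X1 x12.
move=> A1 A2 Y X1 X2 E1 E2 A12 yA Y0 X10 X12.
(* The combination of the two height identities that makes the right side vanish, while the left
   side is a positive plus a nonnegative term. *)
have : (A2 - A1) * (A1 * A2 + Y * X1) + (X2 - X1) * (A1 * (A2 - Y))
   = A1 * ((A2 - Y) * (A2 + X2) - A2) - A2 * ((A1 - Y) * (A1 + X1) - A1) by ring.
rewrite E1 E2 !subrr !mulr0 subrr => e.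
have : 0 < (A2 - A1) * (A1 * A2 + Y * X1).
  by rewrite mulr_gt0 ?subr_gt0 // ltr_pwDl ?mulr_ge0 ?mulr_gt0 //; lra.
have : 0 <= (X2 - X1) * (A1 * (A2 - Y)).
  by rewrite mulr_ge0 ?subr_ge0 // mulr_ge0; lra.
lra.
Qed.

(** As [p q = x y], the claim amounts to [x1 q2 <= x2 q1], which follows from the monotonicity of
    [q] in [x^2] according to the signs of [x1] and [x2]. *)
Lemma sqrt_branch_Re_mono y x1 x2 : 0 < y -> x1 <= x2 ->
  Re (sqrt_branch (x1 +i* y)) <= Re (sqrt_branch (x2 +i* y)).
Proof.
move=> y0 x12.
have /= e1 := sqrt_branch_Im (x1 +i* y); have /= e2 := sqrt_branch_Im (x2 +i* y).
have := sqrt_branch_Im_ge (x1 +i* y) (ltW y0); have := sqrt_branch_Im_ge (x2 +i* y) (ltW y0).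
have m12 := sqrt_branch_Im_anti y x1 x2 y0.
have m21 := sqrt_branch_Im_anti y x2 x1 y0; move: m12 m21 e1 e2 => /=.
move: (sqrt_branch _) (sqrt_branch _) => [p1 q1] [p2 q2] /= m12 m21 e1 e2 q2y q1y.
rewrite -(@ler_pM2r _ (q1 * q2)) ?mulr_gt0 //; try lra.
rewrite mulrA e1 (mulrC q1) mulrA e2.
suff : x1 * q2 <= x2 * q1 by nra.
have [x10|x10] := lerP 0 x1.
  have := m12 ltac:(nra); nra.
have [x20|x20] := lerP x2 0.
  have := m21 ltac:(nra); nra.
nra.
Qed.

End RiemannSums.

(** * Averages of a single map over a grid of centres *)

Section OneStep.
Context {R : realType}.
Implicit Types (x y e d : R) (z u : R[i]).

Lemma complexBE (x y x' y' : R) : (x +i* y) - (x' +i* y') = (x - x') +i* (y - y').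
Proof. by []. Qed.

(** The mean value theorem replaces each term by an increment of [gain_primitive], at a cost of
    [(1 + e^-1) d^2] by the Lipschitz bound; the increments telescope to at most [pi / 2]. *)
Lemma gain_riemann_sum e y d b (k : nat) : 0 < e -> e <= y -> 0 < d ->
  \sum_(c < k) d * (Im (sqrt_branch ((b - c%:R * d) +i* y)) - y)
  <= pi / 2 + k%:R * ((1 + e^-1) * d ^+ 2).
Proof.
move=> e0 ey d0; have y0 : 0 < y by lra.
pose G (c : nat) := - gain_primitive y (b - c%:R * d).
have step (c : nat) : d * (Im (sqrt_branch ((b - c%:R * d) +i* y)) - y)
    <= (G c.+1 - G c) + (1 + e^-1) * d ^+ 2.
  set x := b - c%:R * d.
  have xd : b - c.+1%:R * d = x - d by rewrite /x -natr1; ring.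
  have [|||t] := @MVT_segment R (gain_primitive y) (fun x => Im (sqrt_branch (x +i* y)) - y) (x - d) x.
  - lra.
  - by move=> s _; exact: is_derive_gain_primitive.
  - apply: continuous_subspaceT => s; apply: differentiable_continuous.
    by apply/derivable1_diffP; case: (is_derive_gain_primitive s y y0).
  rewrite in_itv /= => /andP[t1 t2] E.
  rewrite /G xd -/x opprK (addrC (- _)) E.
  have -> : x - (x - d) = d by ring.
  have L := sqrt_branch_lip e (x +i* y) (t +i* y) e0 ey ey.
  have := le_trans (ler_norm _) (le_trans (normc_Im _) L).
  rewrite ImB; have -> : (x +i* y) - (t +i* y) = (x - t)%:C by rewrite complexBE subrr.
  rewrite normcR ger0_norm ?subr_ge0 // => H.
  have K0 : 0 <= 1 + e^-1 by rewrite addr_ge0 // invr_ge0 ltW.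
  have : (1 + e^-1) * (x - t) <= (1 + e^-1) * d by rewrite ler_wpM2l //; lra.
  move: (Im _) (Im _) H => A B H H2.
  rewrite expr2 mulrA (mulrC d) -mulrDl ler_wpM2r //; lra.
apply: (@le_trans _ _ (\sum_(c < k) ((G c.+1 - G c) + (1 + e^-1) * d ^+ 2))).
  by apply: ler_sum => c _; exact: step.
rewrite big_split /= sumr_const card_ord mulr_natl lerD2r.
rewrite -(big_mkord xpredT (fun c => G c.+1 - G c)) telescope_sumr // /G.
have := gain_primitive_bound (b - 0 * d) y y0; have := gain_primitive_bound (b - k%:R * d) y y0.
rewrite !ler_norml => /andP[h1 h2] /andP[h3 h4]; lra.
Qed.

(* [|u / v|] is the modulus of the derivative of [x |-> v]; its integral is at
   most the sum of the variations of [Re v], within [2] of the length of the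
   interval, and of [Im v], at most [2]. *)
Lemma stretch_riemann_sum e y d b (k : nat) : 0 < e -> e <= 1 -> e <= y -> 0 < d ->
  \sum_(c < k) d * (normc ((b - c%:R * d) +i* y) / normc (sqrt_branch ((b - c%:R * d) +i* y)))
  <= k%:R * d + 4 + k%:R * ((1 + e^-1) ^+ 3 * d ^+ 2).
Proof.
move=> e0 e1 ey d0; have y0 : 0 < y by lra.
pose P x := Re (sqrt_branch (x +i* y)); pose Q x := Im (sqrt_branch (x +i* y)).
(* [V] dominates the variation of [Q], which is unimodal around [0]. *)
pose V x := if 0 <= x then Q 0 - Q x else Q x - Q 0.
have anti x1 x2 : x1 ^+ 2 <= x2 ^+ 2 -> Q x2 <= Q x1 by exact: sqrt_branch_Im_anti.
have Q01 x : y <= Q x <= y + 1.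
  have [|h0 h1 _] := @sqrt_branch_gain R (x +i* y); first by rewrite /= ltW.
  by rewrite /= in h0 h1; rewrite /Q; apply/andP; split; lra.
have VQ x1 x2 : x1 <= x2 -> `|Q x2 - Q x1| <= V x2 - V x1.
  move=> x12; have a1 : Q x1 <= Q 0 by apply: anti; rewrite expr0n sqr_ge0.
  have a2 : Q x2 <= Q 0 by apply: anti; rewrite expr0n sqr_ge0.
  rewrite /V; have [x10|x10] := lerP 0 x1.
    rewrite (le_trans x10 x12) ler_norml; have := anti x1 x2 ltac:(nra).
    by move=> h; apply/andP; split; lra.
  have [x20|x20] := lerP 0 x2.
    by rewrite ler_norml; apply/andP; split; lra.
  have := anti x2 x1 ltac:(nra); rewrite ler_norml.
  by move=> h; apply/andP; split; lra.
pose G (c : nat) := - (P (b - c%:R * d) + V (b - c%:R * d)).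
have step (c : nat) :
    d * (normc ((b - c%:R * d) +i* y) / normc (sqrt_branch ((b - c%:R * d) +i* y)))
    <= (G c.+1 - G c) + (1 + e^-1) ^+ 3 * d ^+ 2.
  set x := b - c%:R * d.
  have xd : b - c.+1%:R * d = x - d by rewrite /x -natr1; ring.
  (* Read backwards: the stretching times [d] is at most the increment of the root plus a quadratic
     error. *)
  have := sqrt_branch_derivative e (x +i* y) ((x - d) +i* y) e0 e1 ey ey.
  have -> : (x +i* y) - ((x - d) +i* y) = d%:C by rewrite complexBE subrr; congr Complex; ring.
  rewrite normcR (gtr0_norm d0) ler_norml => /andP[+ _].
  have := normc_le_ReIm (sqrt_branch (x +i* y) - sqrt_branch ((x - d) +i* y)).
  rewrite ReB ImB -/(P x) -/(P (x - d)) -/(Q x) -/(Q (x - d)).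
  have := VQ (x - d) x ltac:(lra).
  have : P (x - d) <= P x by apply: sqrt_branch_Re_mono => //; lra.
  move=> /[dup] Pd; rewrite -subr_ge0 => /ger0_norm -> h1 h2 h3.
  rewrite /G xd -/x; lra.
apply: (@le_trans _ _ (\sum_(c < k) ((G c.+1 - G c) + (1 + e^-1) ^+ 3 * d ^+ 2))).
  by apply: ler_sum => c _; exact: step.
rewrite big_split /= sumr_const card_ord -[X in _ + X <= _]mulr_natl lerD2r.
rewrite -(big_mkord xpredT (fun c => G c.+1 - G c)) telescope_sumr // /G.
have PB x : `|P x - x| <= 1.
  have := le_trans (normc_Re _) (sqrt_branch_dist (x +i* y) (ltW y0)).
  by rewrite ReB.
have VB x : `|V x| <= 1.
  have := Q01 0; have := Q01 x; rewrite /V => /andP[? ?] /andP[? ?].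
  by case: ifP => _; rewrite ler_norml; apply/andP; split; lra.
have := PB (b - 0 * d); have := PB (b - k%:R * d).
have := VB (b - 0 * d); have := VB (b - k%:R * d).
rewrite !ler_norml => /andP[h1 h2] /andP[h3 h4] /andP[h5 h6] /andP[h7 h8]; lra.
Qed.

(** For the root [v], [|u|^2 <= |v|^2 + 1]. With [s = h / (1 + y)] the height identity gives
    [1 <= 8 s |v|^2], and [1 + 8 s <= (1 + 4 s)^2]. *)
Lemma stretch_le u : 1 <= Im u ->
  normc u / normc (sqrt_branch u) <=
  1 + 4 * ((Im (sqrt_branch u) - Im u) / (1 + Im u)).
Proof.
move=> y1; have y0 : 0 <= Im u by lra.
have /= E := sqrt_branch_height u y0; have qy := sqrt_branch_Im_ge u y0.
have e1 := sqrt_branch_Re u; have d := sqrt_branch_dist u y0.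
have n1 : normc u ^+ 2 <= normc (sqrt_branch u) ^+ 2 + 1.
  have -> : normc u ^+ 2 = normc (u ^+ 2) by rewrite !expr2 Normc.normcM.
  have -> : normc (sqrt_branch u) ^+ 2 = normc (sqrt_branch u ^+ 2) by rewrite !expr2 Normc.normcM.
  rewrite sqrt_branch_sqr -{1}(subrK 1 (u ^+ 2)).
  by apply: le_trans (normcD _ _) _; rewrite Normc.normc1.
have := normc_sqr (sqrt_branch u).
move: (normc u) (normc (sqrt_branch u)) (normc_ge0 u) (normc_ge0 (sqrt_branch u)) n1.
move: (sqrt_branch u) E qy e1 {d} => [p q] /=; move: (Re u) (Im u) y0 y1 => x y y0 y1 E qy e1.
move=> U V U0 V0 n1 Vpq.
have V1 : 1 <= V ^+ 2 by have := sqr_ge0 p; nra.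
have Vp : 0 < V by rewrite lt_neqAle V0 andbT; apply/eqP => h; move: V1; rewrite -h; lra.
set h := q - y.
have h0 : 0 <= h by rewrite /h; lra.
have xV : q ^+ 2 + x ^+ 2 <= 2 * V ^+ 2 by rewrite Vpq; nra.
have hV : q <= 4 * (h * V ^+ 2).
  have : q ^+ 2 <= h * (q + y) * (2 * V ^+ 2).
    rewrite -E subr_sqr -/h ler_wpM2l // mulr_ge0 //; lra.
  have : h * (q + y) * (2 * V ^+ 2) <= h * (2 * q) * (2 * V ^+ 2).
    apply: ler_wpM2r; first by lra.
    by apply: ler_wpM2l => //; lra.
  move=> i1 i2; have q0 : 0 < q by lra.
  rewrite -(ler_pM2r q0); nra.
set s := h / (1 + y).
have s0 : 0 <= s by rewrite divr_ge0 //; lra.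
have sV : 1 <= 8 * s * V ^+ 2.
  rewrite /s (_ : 8 * (h / (1 + y)) * V ^+ 2 = (8 * (h * V ^+ 2)) / (1 + y)); last by field; lra.
  rewrite ler_pdivlMr; lra.
rewrite ler_pdivrMr //.
rewrite -(@ler_pXn2r _ 2) ?nnegrE ?mulr_ge0 //; last by lra.
apply: le_trans n1 _; rewrite exprMn.
have : 0 <= s ^+ 2 * V ^+ 2 by rewrite mulr_ge0 ?sqr_ge0.
nra.
Qed.

Definition grid (m d : R) (c : nat) : R := - m + c%:R * d.

(** The modulus of the derivative of [phi x] at [z]. *)
Definition stretch (x : R) z : R := normc (z - x%:C) / normc (sqrt_branch (z - x%:C)).

Lemma stretch_ge0 x z : 0 <= stretch x z.
Proof. by rewrite divr_ge0 ?normc_ge0. Qed.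

Lemma subc_grid m d z c : z - (grid m d c)%:C = ((Re z + m) - c%:R * d) +i* Im z.
Proof. by case: z => x y; rewrite /grid complexBE subr0; congr Complex => /=; ring. Qed.

Lemma gain_grid_sum e m d z (k : nat) : 0 < e -> e <= Im z -> 0 < d ->
  \sum_(c < k) d * (Im (phi (grid m d c) z) - Im z) <= pi / 2 + k%:R * ((1 + e^-1) * d ^+ 2).
Proof.
move=> e0 ez d0; under eq_bigr do rewrite Im_phi subc_grid.
exact: gain_riemann_sum.
Qed.

Lemma stretch_grid_sum e m d z (k : nat) : 0 < e -> e <= 1 -> e <= Im z -> 0 < d ->
  \sum_(c < k) d * stretch (grid m d c) z <= k%:R * d + 4 + k%:R * ((1 + e^-1) ^+ 3 * d ^+ 2).
Proof.
move=> e0 e1 ez d0; under eq_bigr do rewrite /stretch subc_grid.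
exact: stretch_riemann_sum.
Qed.

Lemma phi_gain x z : 0 <= Im z ->
  let h := Im (phi x z) - Im z in
  [/\ 0 <= h, h <= 1 & h * (1 + Im z) <= 3 / 2].
Proof.
move=> z0; have e : Im (z - x%:C) = Im z by rewrite ImB /= subr0.
by have := sqrt_branch_gain (z - x%:C); rewrite e Im_phi; apply.
Qed.

Context (a : nat) (a200 : (200 <= a)%N).

Lemma lyap_phi x z : 0 <= Im z ->
  lyap a (Im (phi x z)) <= (1 + 4 * (Im (phi x z) - Im z)) * lyap a (Im z).
Proof.
move=> z0; have [h0 h1 h2] := phi_gain x z z0.
by rewrite -{1}(subrKC (Im z) (Im (phi x z))) lyap_step // h0 h1.
Qed.

(** Source of the growth rate [2 * pi]: four times the total gain [pi / 2]. The error is stated with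
    a cube so that it also covers the stretching. *)
Lemma gain_lyap_sum e m d z (k : nat) (c : R) : 0 < e -> e <= Im z -> 0 < d -> 0 <= c ->
  \sum_(j < k) d * ((1 + 4 * (Im (phi (grid m d j) z) - Im z)) * c)
  <= (k%:R * d + 2 * pi + 4 * k%:R * ((1 + e^-1) ^+ 3 * d ^+ 2)) * c.
Proof.
move=> e0 ez d0 c0.
rewrite (eq_bigr (fun j : 'I_k => (d + 4 * (d * (Im (phi (grid m d j) z) - Im z))) * c)); last first.
  by move=> j _; ring.
rewrite -mulr_suml ler_wpM2r // big_split /= -mulr_sumr sumr_const card_ord -(mulr_natl _ k).
have := gain_grid_sum e m d z k e0 ez d0.
have K1 : 1 + e^-1 <= (1 + e^-1) ^+ 3.
  by apply: ler_eXnr => //; rewrite lerDl invr_ge0 ltW.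
have : k%:R * ((1 + e^-1) * d ^+ 2) <= k%:R * ((1 + e^-1) ^+ 3 * d ^+ 2).
  by rewrite ler_wpM2l // ler_wpM2r // sqr_ge0.
lra.
Qed.

Lemma lyap_grid_sum e m d z (k : nat) : 0 < e -> e <= Im z -> 0 < d ->
  \sum_(c < k) d * lyap a (Im (phi (grid m d c) z))
  <= (k%:R * d + 2 * pi + 4 * k%:R * ((1 + e^-1) ^+ 3 * d ^+ 2)) * lyap a (Im z).
Proof.
move=> e0 ez d0; have z0 : 0 <= Im z by lra.
apply: le_trans (gain_lyap_sum e m d z k _ e0 ez d0 (ltW (lyap_gt0 a _ z0))).
by apply: ler_sum => c _; rewrite ler_wpM2l ?(ltW d0) // lyap_phi.
Qed.

(* Above height [1] the stretching is absorbed pointwise by the gain in height;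
   below it, [lyap] does not increase and the excess stretching has total mass
   at most [4 <= 2 * pi]. *)
Lemma lyap_stretch_grid_sum e m d z (k : nat) : 0 < e -> e <= 1 -> e <= Im z -> 0 < d ->
  \sum_(c < k) d * (lyap a (Im (phi (grid m d c) z)) * stretch (grid m d c) z)
  <= (k%:R * d + 2 * pi + 4 * k%:R * ((1 + e^-1) ^+ 3 * d ^+ 2)) * lyap a (Im z).
Proof.
move=> e0 e1 ez d0; have z0 : 0 <= Im z by lra.
have l0 := lyap_gt0 a _ z0.
have [z1|z1] := lerP 1 (Im z).
  apply: le_trans (gain_lyap_sum e m d z k _ e0 ez d0 (ltW l0)).
  apply: ler_sum => c _; rewrite ler_wpM2l ?(ltW d0) //.
  have [h0 h1 h2] := phi_gain (grid m d c) z z0.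
  rewrite -{1}(subrKC (Im z) (Im (phi _ z))) lyap_step_high //; first by rewrite h0 h1.
  rewrite stretch_ge0 /=.
  have E : Im (z - (grid m d c)%:C) = Im z by rewrite ImB /= subr0.
  by have := stretch_le (z - (grid m d c)%:C); rewrite E Im_phi; apply.
apply: (@le_trans _ _ (\sum_(c < k) (d * stretch (grid m d c) z) * lyap a (Im z))).
  apply: ler_sum => c _; rewrite -mulrA ler_wpM2l ?(ltW d0) // mulrC ler_wpM2l ?stretch_ge0 //.
  have [h0 h1 h2] := phi_gain (grid m d c) z z0.
  by rewrite -{1}(subrKC (Im z) (Im (phi _ z))) lyap_step_low // ?h0 ?z0 // ltW.
rewrite -mulr_suml ler_wpM2r ?(ltW l0) //.
have := stretch_grid_sum e m d z k e0 e1 ez d0; have := @pi_ge2 R.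
have : 0 <= k%:R * ((1 + e^-1) ^+ 3 * d ^+ 2).
  by rewrite mulr_ge0 // mulr_ge0 ?sqr_ge0 // exprn_ge0 // addr_ge0 // invr_ge0 ltW.
lra.
Qed.

End OneStep.

(** * The discretised process *)

Section Chain.
Context {R : realType} {I : finType} {X : Type}.
Variables (p : I -> R) (step : I -> X -> X).

Definition run (x : X) (s : seq I) : X := foldl (fun x i => step i x) x s.

(** The weights [p] need not sum to 1; later, slices with several points carry the missing mass. *)
Definition path_mean (n : nat) (G : X -> R) (x : X) : R :=
  \sum_(s : n.-tuple I) (\prod_(i <- s) p i) * G (run x s).

Lemma path_mean0 G x : path_mean 0 G x = G x.
Proof.
rewrite /path_mean (big_pred1 [tuple]); last by move=> s; apply/esym/eqP; exact: tuple0.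
by rewrite big_nil mul1r.
Qed.

Lemma path_meanS n G x : path_mean n.+1 G x = \sum_i p i * path_mean n G (step i x).
Proof.
under eq_bigr do rewrite mulr_sumr.
rewrite pair_big /path_mean (reindex (fun q : I * n.-tuple I => [tuple of q.1 :: q.2])) /=.
  by apply: eq_bigr => -[i s] _ /=; rewrite big_cons mulrA.
exists (fun s => (thead s, [tuple of behead s])) => [[i s] _|s _] /=.
  by congr pair; apply: val_inj.
by rewrite [RHS]tuple_eta; apply: val_inj.
Qed.

Lemma path_mean_total n x : path_mean n (fun=> 1) x = (\sum_i p i) ^+ n.
Proof.
elim: n x => [|n IH] x; first by rewrite path_mean0 expr0.
by rewrite path_meanS exprS mulr_suml; apply: eq_bigr => i _; rewrite IH.
Qed.

(** [Inv] is indexed by the number of steps left, so that it can reserve room for the expansion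
    still to come. *)
Lemma path_mean_le (Inv : nat -> X -> Prop) (rho : R) G n x :
  (forall i, 0 <= p i) -> 0 <= rho ->
  (forall n x i, Inv n.+1 x -> Inv n (step i x)) ->
  (forall n x, Inv n.+1 x -> \sum_i p i * G (step i x) <= rho * G x) ->
  Inv n x -> path_mean n G x <= rho ^+ n * G x.
Proof.
move=> p0 rho0 Istep Gstep; elim: n x => [|n IH] x Ix; first by rewrite path_mean0 expr0 mul1r.
rewrite path_meanS exprSr -mulrA; apply: le_trans (ler_wpM2l _ (Gstep _ _ Ix)); last exact: exprn_ge0.
rewrite mulr_sumr; apply: ler_sum => i _.
by rewrite [leRHS]mulrCA; apply: ler_wpM2l => //; apply/IH/Istep.
Qed.

End Chain.

(** * The flow with at most one grid map per time slice *)

Section DiscreteModel.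
Context {R : realType}.
Context (a : nat) (a200 : (200 <= a)%N).
Context (k n : nat) (m d tau e D E K : R).
Context (e0 : 0 < e) (e1 : e <= 1) (d0 : 0 < d) (tau0 : 0 < tau) (D0 : 0 <= D).
Context (KE : K = 1 + e^-1).
Context (errE : 4 * k%:R * (K ^+ 3 * d ^+ 2) + 5 * (k%:R * d) * (K ^+ 3 * D) <= E).
Implicit Types (z w : R[i]) (o : option 'I_k).

(* The probability that a time slice of duration [tau], over [k] cells of width
   [d], contains no point, or exactly one point lying in a given cell. *)
Definition weight o : R :=
  expR (- (k%:R * (d * tau))) * (if o is Some _ then d * tau else 1).

Definition evolve o z : R[i] := if o is Some c then phi (grid m d c) z else z.

Definition evolve2 o (q : R[i] * R[i]) := (evolve o q.1, evolve o q.2).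

Lemma weight_ge0 o : 0 <= weight o.
Proof. by rewrite mulr_ge0 ?expR_ge0 //; case: o => // _; rewrite mulr_ge0 // ltW. Qed.

Lemma weight_sum (G : option 'I_k -> R) :
  \sum_o weight o * G o = expR (- (k%:R * (d * tau))) *
    (G None + tau * \sum_(c < k) d * G (Some c)).
Proof.
rewrite (bigD1 None) //= {1}/weight mulr1 mulrDr; congr (_ + _).
rewrite !mulr_sumr (reindex_omap Some id) /=; last by case.
by under eq_bigl do rewrite eqxx; apply: eq_bigr => c _; rewrite /weight; ring.
Qed.

Lemma weight_total : \sum_o weight o = expR (- (k%:R * (d * tau))) * (1 + k%:R * (d * tau)).
Proof.
have := weight_sum (fun=> 1); under eq_bigr do rewrite mulr1.
move=> ->; rewrite -mulr_sumr sumr_const card_ord -mulr_natl; congr (_ * (_ + _)); ring.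
Qed.

Lemma Im_evolve_ge o z : 0 <= Im z -> Im z <= Im (evolve o z).
Proof. by case: o => //= c; exact: Im_phi_ge. Qed.

Lemma Im_evolve_ge_floor o z : e <= Im z -> e <= Im (evolve o z).
Proof. by move=> ez; apply: (le_trans ez); apply: Im_evolve_ge; exact: le_trans (ltW e0) ez. Qed.

Lemma normc_evolve_sub o z w : e <= Im z -> e <= Im w ->
  normc (evolve o z - evolve o w) <= K * normc (z - w).
Proof.
move=> ez ew; have K1 : 1 <= K by rewrite KE lerDl invr_ge0 ltW.
case: o => [c|] /=; last by rewrite ler_peMl ?normc_ge0.
rewrite !phiE (_ : _ - _ = 
  sqrt_branch (z - (grid m d c)%:C) - sqrt_branch (w - (grid m d c)%:C)); last by ring.
rewrite -[z - w](_ : (z - (grid m d c)%:C) - (w - (grid m d c)%:C) = _); last by ring.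
by rewrite KE; apply: sqrt_branch_lip => //; rewrite ImB /= subr0.
Qed.

(** The normalisation of [weight] cancels the total width [k d] of the grid, leaving only the excess
    rate. *)
Lemma expR_step (rate : R) : 0 <= rate ->
  expR (- (k%:R * (d * tau))) * (1 + tau * (k%:R * d + rate)) <= expR (tau * rate).
Proof.
move=> r0; apply: le_trans (ler_wpM2l (expR_ge0 _) (expR_ge1Dx _)) _.
by rewrite -expRD ler_expR; lra.
Qed.

Let K0 : 0 < K. Proof. by rewrite KE addr_gt0 // invr_gt0. Qed.

Let E0 : 0 <= E.
Proof.
apply: le_trans errE; have K3 : 0 <= K ^+ 3 by rewrite exprn_ge0 // ltW.
have dd := ltW d0; have kn : 0 <= k%:R :> R by [].
have p1 : 0 <= K ^+ 3 * d ^+ 2 by rewrite mulr_ge0 // exprn_ge0.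
have p2 : 0 <= K ^+ 3 * D by rewrite mulr_ge0.
by rewrite addr_ge0 // mulr_ge0 // mulr_ge0 // mulr_ge0.
Qed.

Let err1 : 4 * k%:R * (K ^+ 3 * d ^+ 2) <= E.
Proof.
apply: le_trans errE; rewrite lerDl; have K3 : 0 <= K ^+ 3 by rewrite exprn_ge0 // ltW.
by rewrite !mulr_ge0 // ltW.
Qed.

Lemma lyap_evolve z : e <= Im z ->
  \sum_o weight o * lyap a (Im (evolve o z)) <= expR (tau * (2 * pi + E)) * lyap a (Im z).
Proof.
move=> ez; have l0 : 0 < lyap a (Im z) by apply: lyap_gt0; exact: le_trans (ltW e0) ez.
rewrite weight_sum /=.
have S := lyap_grid_sum a a200 e m d z k e0 ez d0; rewrite -KE in S.
have E1 : 0 <= 2 * pi + E by rewrite addr_ge0 // mulr_ge0 ?pi_ge0.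
apply: le_trans (ler_wpM2r (ltW l0) (expR_step _ E1)).
rewrite -mulrA ler_wpM2l ?expR_ge0 // mulrDl mul1r lerD2l -mulrA ler_wpM2l ?(ltW tau0) //.
apply: le_trans S _; rewrite ler_wpM2r ?(ltW l0) //; have := err1; lra.
Qed.

(* The discrete counterpart of [|F'| f(Im F)]. *)
Definition spread (q : R[i] * R[i]) : R := normc (q.1 - q.2) * lyap a (Im q.1).

(** Both points undergo the same map, so to first order their distance is multiplied by [stretch].
    The remainder [K^3 |z - w|^2] is at most [K^3 D |z - w|] and goes into [E]. *)
Lemma spread_evolve z w : e <= Im z -> e <= Im w -> normc (z - w) <= D ->
  \sum_o weight o * spread (evolve2 o (z, w)) <= expR (tau * (2 * pi + E)) * spread (z, w).
Proof.
move=> ez ew zwD; have l0 : 0 < lyap a (Im z) by apply: lyap_gt0; exact: le_trans (ltW e0) ez.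
have z0 : 0 <= Im z := le_trans (ltW e0) ez.
rewrite weight_sum /spread /=; set N := normc (z - w).
have N0 : 0 <= N by exact: normc_ge0.
have K3 : 0 <= K ^+ 3 by rewrite exprn_ge0 // ltW.
have S := lyap_stretch_grid_sum a a200 e m d z k e0 e1 ez d0; rewrite -KE in S.
have E1 : 0 <= 2 * pi + E by rewrite addr_ge0 // mulr_ge0 ?pi_ge0.
have T : \sum_(c < k) d * (normc (phi (grid m d c) z - phi (grid m d c) w) * lyap a (Im (phi (grid m d c) z)))
  <= N * ((k%:R * d + (2 * pi + E)) * lyap a (Im z)).
  apply: (@le_trans _ _ (N * \sum_(c < k) (d * (lyap a (Im (phi (grid m d c) z)) * stretch (grid m d c) z)
      + d * (5 * (K ^+ 3 * D)) * lyap a (Im z)))).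
    rewrite mulr_sumr; apply: ler_sum => c _.
    set x := grid m d c; set q := Im (phi x z).
    have [h0 h1 _] := phi_gain x z z0.
    have q0 : 0 <= q by rewrite /q; lra.
    (* The gain is at most 1, so the factor [1 + 4 h] is at most 5; this is the 5 in the error
       bound. *)
    have lq : lyap a q <= 5 * lyap a (Im z).
      apply: le_trans (lyap_phi a a200 x z z0) _; rewrite ler_wpM2r ?(ltW l0) //; lra.
    have lq0 := ltW (lyap_gt0 a _ q0).
    have := sqrt_branch_derivative e (z - x%:C) (w - x%:C) e0 e1.
    rewrite !ImB /= !subr0 => /(_ ez ew).
    rewrite -/(stretch x z).
    have -> : normc (z - x%:C - (w - x%:C)) = N by rewrite /N; congr normc; ring.
    rewrite !phiE (_ : _ + _ - _ = sqrt_branch (z - x%:C) - sqrt_branch (w - x%:C)); last by ring.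
    rewrite ler_norml => /andP[_ H].
    have H2 : normc (sqrt_branch (z - x%:C) - sqrt_branch (w - x%:C)) <= N * (stretch x z + K ^+ 3 * D).
      have : K ^+ 3 * N ^+ 2 <= N * (K ^+ 3 * D).
        by rewrite expr2 mulrCA ler_wpM2l // ler_wpM2l.
      rewrite -KE in H; lra.
    apply: (@le_trans _ _ (d * ((N * (stretch x z + K ^+ 3 * D)) * lyap a q))).
      by rewrite ler_wpM2l ?(ltW d0) // ler_wpM2r.
    rewrite (_ : d * (N * (stretch x z + K ^+ 3 * D) * lyap a q)
       = N * (d * (lyap a q * stretch x z) + d * (K ^+ 3 * D * lyap a q))); last by ring.
    apply: ler_wpM2l => //; rewrite lerD2l -[leRHS]mulrA; apply: ler_wpM2l; first exact: ltW.
    rewrite (_ : 5 * (K ^+ 3 * D) * lyap a (Im z) = (K ^+ 3 * D) * (5 * lyap a (Im z))); last by ring.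
    by rewrite ler_wpM2l // mulr_ge0.
  rewrite ler_wpM2l // big_split /= sumr_const card_ord -[X in _ + X <= _]mulr_natl.
  apply: le_trans (lerD S (lexx _)) _.
  rewrite (_ : k%:R * (d * (5 * (K ^+ 3 * D)) * lyap a (Im z))
    = 5 * (k%:R * d) * (K ^+ 3 * D) * lyap a (Im z)); last by ring.
  rewrite -mulrDl ler_wpM2r ?(ltW l0) //; have := errE; lra.
have NL0 : 0 <= N * lyap a (Im z) by rewrite mulr_ge0 // ltW.
apply: le_trans (ler_wpM2r NL0 (expR_step _ E1)).
rewrite -mulrA ler_wpM2l ?expR_ge0 // mulrDl mul1r lerD2l -mulrA ler_wpM2l ?(ltW tau0) //.
by apply: le_trans T _; rewrite le_eqVlt; apply/orP; left; apply/eqP; ring.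
Qed.

Lemma lyap_path z : e <= Im z ->
  path_mean weight evolve n (fun w => lyap a (Im w)) z
  <= expR (n%:R * tau * (2 * pi + E)) * lyap a (Im z).
Proof.
move=> ez; rewrite -mulrA expRM_natl.
apply: (path_mean_le _ _ (fun _ w => e <= Im w)) => //.
- exact: weight_ge0.
- by move=> _ w o; exact: Im_evolve_ge_floor.
- by move=> _ w; exact: lyap_evolve.
Qed.

Let K1 : 1 <= K. Proof. by rewrite KE lerDl invr_ge0 ltW. Qed.

Lemma spread_path z w : e <= Im z -> e <= Im w -> normc (z - w) * K ^+ n <= D ->
  path_mean weight evolve2 n spread (z, w)
  <= expR (n%:R * tau * (2 * pi + E)) * spread (z, w).
Proof.
move=> ez ew zwD; rewrite -mulrA expRM_natl.
(* One map expands distances by at most [K]; reserving [K^j] for the [j] steps left keeps every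
   later distance below [D]. *)
apply: (path_mean_le _ _ (fun j q => [/\ e <= Im q.1, e <= Im q.2 & normc (q.1 - q.2) * K ^+ j <= D])) => //.
- exact: weight_ge0.
- move=> j [z' w'] o /= [h1 h2 h3]; split; try exact: Im_evolve_ge_floor.
  apply: le_trans h3; rewrite exprS mulrA ler_wpM2r ?exprn_ge0 ?(ltW K0) // mulrC.
  exact: normc_evolve_sub.
- move=> j [z' w'] /= [h1 h2 h3]; apply: spread_evolve => //.
  by apply: le_trans h3; rewrite ler_peMr ?normc_ge0 // exprn_ege1.
Qed.

Lemma run_evolve2 z w s : run evolve2 (z, w) s = (run evolve z s, run evolve w s).
Proof. by rewrite /run; elim: s z w => //= o s IH z w; rewrite IH. Qed.

Lemma Im_run_ge s z : e <= Im z -> e <= Im (run evolve z s).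
Proof. by elim: s z => //= o s IH z ez; apply/IH/Im_evolve_ge_floor. Qed.

Lemma normc_run_sub s z w : e <= Im z -> e <= Im w ->
  normc (run evolve z s - run evolve w s) <= normc (z - w) * K ^+ size s.
Proof.
elim: s z w => [|o s IH] z w ez ew /=; first by rewrite expr0 mulr1.
apply: le_trans (IH _ _ (Im_evolve_ge_floor o z ez) (Im_evolve_ge_floor o w ew)) _.
rewrite exprS mulrA ler_wpM2r ?exprn_ge0 ?(ltW K0) // mulrC.
exact: normc_evolve_sub.
Qed.

Lemma expR_le_affine (x : R) : 0 <= x <= 1 -> expR x <= 1 + 4 * x.
Proof.
move=> x01; apply: le_trans (expR_quadratic x x01) _; case/andP: x01 => x0 x1; nra.
Qed.

Definition net (l : R) (j : nat) : R[i] := (j%:R * l) +i* e.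

(** From one net point to the next, [lyap] grows by at most a multiple of [spread]: [lyap_loglip],
    linearised thanks to [(4 + a) D <= 1]. The increments are then summed. *)
Lemma lyap_net (l : R) s j : 0 <= l -> (4 + a%:R) * D <= 1 -> l * K ^+ size s <= D ->
  lyap a (Im (run evolve (net l j) s)) <= lyap a (Im (run evolve (net l 0) s)) +
  4 * (4 + a%:R) * \sum_(i < j) spread (run evolve2 (net l i, net l i.+1) s).
Proof.
move=> l0 aD lD; elim: j => [|j IH]; first by rewrite big_ord0 mulr0 addr0.
rewrite big_ord_recr /= mulrDr addrA.
have g i : e <= Im (run evolve (net l i) s) by apply: Im_run_ge.
apply: le_trans (_ : lyap a (Im (run evolve (net l j) s))
  + 4 * (4 + a%:R) * spread (run evolve2 (net l j, net l j.+1) s) <= _); last by rewrite lerD2r.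
rewrite run_evolve2 /spread /=; set z := run evolve (net l j) s; set w := run evolve (net l j.+1) s.
have N : normc (z - w) <= D.
  apply: le_trans (normc_run_sub s _ _ _ _) _ => //.
  apply: le_trans lD; rewrite ler_wpM2r ?exprn_ge0 ?(ltW K0) //.
  rewrite /net complexBE subrr (_ : _ - _ = - l); last by rewrite -natr1; ring.
  by rewrite -/((- l)%:C) normcR normrN ger0_norm.
have zy : 0 <= Im z := le_trans (ltW e0) (g j).
have wy : 0 <= Im w := le_trans (ltW e0) (g j.+1).
have lz := lyap_gt0 a _ zy.
apply: le_trans (lyap_loglip a _ _ zy wy) _.
have ND : `|Im w - Im z| <= normc (z - w) by rewrite -ImB -normcB normc_Im.
have a0 : 0 <= 4 + a%:R :> R by rewrite addr_ge0.
have x01 : 0 <= (4 + a%:R) * `|Im w - Im z| <= 1.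
  rewrite mulr_ge0 //=; apply: le_trans aD; rewrite ler_wpM2l //; exact: le_trans N.
apply: le_trans (ler_wpM2l (ltW lz) (expR_le_affine _ x01)) _.
rewrite mulrDr mulr1 lerD2l.
rewrite (_ : 4 * (4 + a%:R) * (normc (z - w) * lyap a (Im z))
  = lyap a (Im z) * (4 * ((4 + a%:R) * normc (z - w)))); last by ring.
by rewrite ler_wpM2l ?(ltW lz) // ler_wpM2l // ler_wpM2l.
Qed.

(** Markov's inequality at level [lyap a L]; [lyap] is monotone above [L]. *)
Lemma path_exceed (l L : R) (J : nat) : 0 <= l -> (4 + a%:R) * D <= 1 -> l * K ^+ n <= D ->
  0 <= L -> a%:R <= 4 * (1 + L) ->
  \sum_(s : n.-tuple (option 'I_k) | [exists j : 'I_J.+1, L <= Im (run evolve (net l j) s)])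
     \prod_(o <- s) weight o
  <= expR (n%:R * tau * (2 * pi + E)) * lyap a e * (1 + 4 * (4 + a%:R) * (J%:R * l)) / lyap a L.
Proof.
move=> l0 aD lD L0 aL; have lL := lyap_gt0 a _ L0.
have a0 : 0 <= 4 + a%:R :> R by rewrite addr_ge0.
have W s : 0 <= \prod_(o <- s) weight o by apply: prodr_ge0 => o _; exact: weight_ge0.
have S0 q : e <= Im q.1 -> 0 <= spread q.
  by move=> h; rewrite mulr_ge0 ?normc_ge0 // ltW // lyap_gt0 // (le_trans (ltW e0) h).
rewrite ler_pdivlMr // mulr_suml.
(* All spreads being nonnegative, [B] dominates [lyap] at every net point simultaneously, hence the
   maximum. *)
pose B (s : seq (option 'I_k)) := lyap a (Im (run evolve (net l 0) s)) +
  4 * (4 + a%:R) * \sum_(i < J) spread (run evolve2 (net l i, net l i.+1) s).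
have B0 s : 0 <= B s.
  apply: addr_ge0.
    have h : e <= Im (run evolve (net l 0) s) by apply: Im_run_ge.
    by rewrite ltW // lyap_gt0 // (le_trans (ltW e0) h).
  rewrite mulr_ge0 ?mulr_ge0 //; apply: sumr_ge0 => i _; apply: S0.
  by rewrite run_evolve2; exact: Im_run_ge.
apply: (@le_trans _ _ (\sum_(s : n.-tuple (option 'I_k)) (\prod_(o <- s) weight o) * B s)).
  rewrite [leRHS](bigID (fun s : n.-tuple (option 'I_k) =>
    [exists j : 'I_J.+1, L <= Im (run evolve (net l j) s)])) /=.
  apply: le_trans (_ : _ <= \sum_(s : n.-tuple (option 'I_k) |
      [exists j : 'I_J.+1, L <= Im (run evolve (net l j) s)]) (\prod_(o <- s) weight o) * B s) _; last first.
    by rewrite lerDl; apply: sumr_ge0 => s _; rewrite mulr_ge0.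
  apply: ler_sum => s /existsP[j Lj]; rewrite ler_wpM2l //.
  apply: le_trans (lyap_mono a _ _ L0 aL Lj) _.
  apply: le_trans (lyap_net l s j l0 aD _) _; first by rewrite size_tuple.
  rewrite lerD2l ler_wpM2l ?mulr_ge0 //.
  rewrite -(big_mkord xpredT (fun i => spread (run evolve2 (net l i, net l i.+1) s))).
  rewrite -(big_mkord xpredT (fun i => spread (run evolve2 (net l i, net l i.+1) s))).
  rewrite [leRHS](big_cat_nat _ (n := j)) //=; last by rewrite -ltnS.
  rewrite lerDl; apply: sumr_ge0 => i _; apply: S0.
  by rewrite run_evolve2; exact: Im_run_ge.
rewrite /B; under eq_bigr do rewrite mulrDr.
rewrite big_split /=.
have P1 := lyap_path (net l 0) (lexx _).
set X := expR _ in P1 *.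
have P2 (i : nat) : path_mean weight evolve2 n spread (net l i, net l i.+1) <= X * (l * lyap a e).
  have Nl : normc (net l i - net l i.+1) = l.
    rewrite /net complexBE subrr (_ : _ - _ = - l); last by rewrite -natr1; ring.
    by rewrite -/((- l)%:C) normcR normrN ger0_norm.
  apply: le_trans (spread_path _ _ _ _ _) _ => //; first by rewrite Nl.
  by apply: ler_wpM2l; [exact: expR_ge0|rewrite /spread [_.1 - _]/= Nl].
have -> : X * lyap a e * (1 + 4 * (4 + a%:R) * (J%:R * l))
  = X * lyap a e + 4 * (4 + a%:R) * \sum_(i < J) X * (l * lyap a e).
  by rewrite sumr_const card_ord -mulr_natl; ring.
rewrite lerD //.
rewrite (_ : \sum_(s : n.-tuple (option 'I_k)) _ = 4 * (4 + a%:R) *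
   \sum_(i < J) path_mean weight evolve2 n spread (net l i, net l i.+1)).
  by rewrite ler_wpM2l ?mulr_ge0 //; apply: ler_sum => i _; exact: P2.
rewrite /path_mean exchange_big /= mulr_sumr; apply: eq_bigr => s _.
by rewrite -mulr_sumr; ring.
Qed.

End DiscreteModel.

(** * Patterns of Poisson points *)

Section Cells.
Context {R : realType}.
Implicit Types (b w x : R) (c k : nat).

(* The last cell is closed on the right, so that the [k] cells partition the
   closed interval [[b, b + k w]]. *)
Definition cell b w k c : interval R :=
  Interval (BLeft (b + c%:R * w)) (BSide (c.+1 < k)%N (b + c.+1%:R * w)).

Lemma in_cell b w k c x : x \in cell b w k c -> b + c%:R * w <= x <= b + c.+1%:R * w.
Proof.
rewrite /cell in_itv; case: (_ < _)%N => /= /andP[-> //=]; exact: ltW.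
Qed.

Lemma cell_cover b w k x : (0 < k)%N -> 0 < w -> b <= x <= b + k%:R * w ->
  exists2 c, (c < k)%N & x \in cell b w k c.
Proof.
move=> k0 w0; elim: k k0 => // k IH _ /andP[x1 x2].
case: k IH x2 => [|k] IH x2.
  by exists 0%N => //; rewrite /cell in_itv /= mul0r addr0 x1.
have [x3|x3] := ltrP x (b + k.+1%:R * w); last first.
  by exists k.+1 => //; rewrite /cell in_itv ltnn /= x3.
have [//||c ck] := IH; first by rewrite x1 ltW.
rewrite /cell !in_itv => /andP[x4 x5]; exists c; first exact: ltnW.
rewrite in_itv x4 ltnS ck /=; case: ltnP x5 => //= kc _.
by have -> : c = k by apply/eqP; rewrite eqn_leq -ltnS ck -ltnS.
Qed.

Lemma cell_lt b w k c c' x x' : 0 < w -> (c < c')%N -> (c' < k)%N ->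
  x \in cell b w k c -> x' \in cell b w k c' -> x < x'.
Proof.
move=> w0 cc ck; rewrite /cell in_itv (leq_ltn_trans cc ck) /= => /andP[_ x1] /in_cell /andP[x2 _].
apply: (lt_le_trans x1); apply: le_trans x2.
by rewrite lerD2l ler_wpM2r ?(ltW w0) // ler_nat.
Qed.

Lemma lebesgue_cell b w k c : 0 < w -> lebesgue_measure [set` cell b w k c] = w%:E.
Proof.
move=> w0; rewrite /cell lebesgue_measure_itv /= lte_fin.
rewrite ltrD2l ltr_pM2r // ltr_nat ltnS leqnn -EFinB; congr EFin.
by rewrite -natr1; ring.
Qed.

End Cells.

(** * Reading the flow off a pattern of occupied boxes *)

Section Pattern.
Context {R : realType}.
Context (k n : nat) (m d tau t : R).
Context (k0 : (0 < k)%N) (n0 : (0 < n)%N) (d0 : 0 < d) (tau0 : 0 < tau).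
Context (kd : k%:R * d = 2 * m) (nt : n%:R * tau = t).
Implicit Types (S : set (R * R)) (s : n.-tuple (option 'I_k)).

(** The index is (time slice, space cell), in the opposite order to the coordinates in the plane. *)
Definition box (q : 'I_n * 'I_k) : set (R * R) :=
  [set` cell (- m) d k q.2] `*` [set` cell 0 tau n q.1].

Lemma box_cover (p : R * R) : - m <= p.1 <= m -> 0 <= p.2 <= t -> exists q, box q p.
Proof.
move=> p1 p2.
have [|c ck hc] := cell_cover (- m) d k p.1 k0 d0; first by rewrite kd (_ : - m + 2 * m = m) //; ring.
have [|i ik hi] := cell_cover 0 tau n p.2 n0 tau0; first by rewrite add0r nt.
by exists (Ordinal ik, Ordinal ck); split.
Qed.

Lemma box_sub (q : 'I_n * 'I_k) (p : R * R) : box q p ->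
  [/\ - m <= p.1 <= m, 0 <= p.2 <= t & `|p.1 - grid m d q.2| <= d].
Proof.
case: q => i c [] /= /in_cell /andP[h1 h2] /in_cell /andP[h3 h4].
have c0 : 0 <= c%:R * d by rewrite mulr_ge0 // ltW.
have i0 : 0 <= i%:R * tau by rewrite mulr_ge0 // ltW.
have c1 : c.+1%:R * d <= k%:R * d by rewrite ler_wpM2r ?(ltW d0) // ler_nat.
have i1 : i.+1%:R * tau <= n%:R * tau by rewrite ler_wpM2r ?(ltW tau0) // ler_nat.
have kd' := kd; have nt' := nt.
split; try (apply/andP; split; lra).
rewrite -natr1 in h2; rewrite /grid ler_norml; apply/andP; split; have := d0; lra.
Qed.

Lemma box_disjoint (q q' : 'I_n * 'I_k) : q != q' -> box q `&` box q' = set0.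
Proof.
move=> qq; apply/seteqP; split => // p [[/= a1 a2] [b1 b2]].
case: q q' qq a1 a2 b1 b2 => [i c] [i' c'] /= qq a1 a2 b1 b2; case/eqP: qq.
have cE : c = c'.
  apply/val_inj => /=; have [h|h|//] := ltngtP (c : nat) c'.
    by have := cell_lt (- m) d k c c' p.1 p.1 d0 h (ltn_ord c') a1 b1; rewrite ltxx.
  by have := cell_lt (- m) d k c' c p.1 p.1 d0 h (ltn_ord c) b1 a1; rewrite ltxx.
have iE : i = i'.
  apply/val_inj => /=; have [h|h|//] := ltngtP (i : nat) i'.
    by have := cell_lt 0 tau n i i' p.2 p.2 tau0 h (ltn_ord i') a2 b2; rewrite ltxx.
  by have := cell_lt 0 tau n i' i p.2 p.2 tau0 h (ltn_ord i) b2 a2; rewrite ltxx.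
by rewrite cE iE.
Qed.

(** At most one point of the window lies in each slice, so time order is slice order. *)
Definition pattern S s : Prop :=
  forall q : 'I_n * 'I_k, npoints S (box q) = (tnth s q.1 == Some q.2) :> nat.

Lemma npoints1 S (B : set (R * R)) : finite_set (S `&` B) -> npoints S B = 1%N ->
  exists p, S `&` B = [set p].
Proof.
move=> fin /eqP /cardfs1P[p E]; exists p.
by rewrite -(fset_setK fin) E; apply/seteqP; split => x /=; rewrite inE => /eqP.
Qed.

Lemma npoints_gt0 S (B : set (R * R)) p : finite_set (S `&` B) -> S p -> B p ->
  npoints S B <> 0%N.
Proof.
move=> fin Sp Bp /eqP; rewrite cardfs_eq0 => /eqP E.
have : p \in fset_set (S `&` B) by rewrite in_fset_set //; apply/mem_set.
by rewrite E inE.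
Qed.

Lemma foldl_map (X Y Z : Type) (f : X -> Y -> X) (h : Z -> Y) (s : seq Z) x :
  foldl f x (map h s) = foldl (fun x z => f x (h z)) x s.
Proof. by elim: s x => //= z s IH x; rewrite IH. Qed.

(** The list [l] pairs each true position with that of its grid point. The first alternative is the
    default value of [Fm]. *)
Lemma pattern_Fm S s :
  S `<=` [set p | 0 <= p.2] -> (forall q, finite_set (S `&` box q)) -> pattern S s ->
  exists l : seq (R * R), [/\ (size l <= n)%N, all (fun p => `|p.1 - p.2| <= d) l,
    (forall z, Fm S m t z = z \/ Fm S m t z = foldl (fun w p => phi p.1 w) z l) &
    (forall z, run (evolve k m d) z s = foldl (fun w p => phi p.2 w) z l)].
Proof.
move=> S0 fin pat.
have ex i : exists p, forall c, tnth s i = Some c -> S `&` box (i, c) = [set p].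
  case E : (tnth s i) => [c|]; last by exists (0, 0).
  have [|p Hp] := npoints1 S (box (i, c)) (fin _); first by rewrite pat /= E eqxx.
  by exists p => c' [<-].
have [pt Hpt] := choice ex.
pose g i : R := if tnth s i is Some c then grid m d c else 0.
pose idx := [seq i <- enum 'I_n | isSome (tnth s i)].
have ptP i c : tnth s i = Some c -> S (pt i) /\ box (i, c) (pt i).
  by move=> /Hpt E; have : [set pt i] (pt i) by []; rewrite -E.
exists [seq ((pt i).1, g i) | i <- idx]; split.
- by rewrite size_map size_filter (leq_trans (count_size _ _)) // size_enum_ord.
- apply/allP => p /mapP[j]; rewrite mem_filter => /andP[+ _].
  case E : (tnth s j) => [c|] // _ -> /=; rewrite /g E.
  by have [_ /box_sub[]] := ptP j c E.
- move=> z; rewrite /Fm; case: pselect => [h|h]; last by left.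
  right; case: cid => u /= [su Eu].
  have -> : u = [seq pt i | i <- idx].
    (* A strictly sorted enumeration is unique, so the one chosen inside [Fm] is the enumeration by
       slices. *)
    apply: (@irr_sorted_eq _ (fun p q : R * R => p.2 < q.2)) => //.
    + by move=> x y w; exact: lt_trans.
    + apply: (@homo_sorted_in _ _ (fun i => isSome (tnth s i)) pt (fun i j => (i < j)%N)).
      * move=> i j; rewrite /in_mem /=.
        case Ei : (tnth s i) => [c|] // _; case Ej : (tnth s j) => [c'|] // _ ij.
        have [_ [_ /= hi]] := ptP i c Ei; have [_ [_ /= hj]] := ptP j c' Ej.
        exact: cell_lt hi hj.
      * by apply/allP => i; rewrite mem_filter => /andP[].
      * apply: sorted_filter; first by move=> x y w; exact: ltn_trans.
        by have := iota_ltn_sorted 0 n; rewrite -val_enum_ord sorted_map.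
    + move=> p; apply/idP/idP => [pu|/mapP[j]].
        have [Sp [/= p1 p2]] : (S `&` [set p | - m <= p.1 <= m /\ p.2 <= t]) p by rewrite -Eu.
        have [|[i c] Bp] := box_cover p p1; first by rewrite (S0 _ Sp).
        have Ei : tnth s i = Some c.
          by have := npoints_gt0 S _ p (fin (i, c)) Sp Bp; rewrite pat /=; case: eqP.
        apply/mapP; exists i; first by rewrite mem_filter Ei /= mem_enum.
        by have : (S `&` box (i, c)) p by []; rewrite (Hpt _ _ Ei).
      rewrite mem_filter => /andP[]; case Ej : (tnth s j) => [c|] // _ _ ->.
      have [Sp /box_sub[b1 /andP[_ b2] _]] := ptP j c Ej.
      by have : (S `&` [set p | - m <= p.1 <= m /\ p.2 <= t]) (pt j) by []; rewrite -Eu.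
  by rewrite /compose_maps !foldl_map.
- move=> z; rewrite foldl_map /run -{1}(map_tnth_enum s) foldl_map /idx.
  elim: (enum 'I_n) z => //= i e IH z; rewrite IH.
  by case E : (tnth s i) => [c|] //=; rewrite /g E.
Qed.

(** The net point below [x] is within [l + e] of it, and each centre within [d] of its grid point;
    the images then differ by at most 1, which is the loss from [L + 1] to [L]. *)
Lemma pattern_exceed (e l delta L : R) (J : nat) S s (x : R) :
  S `<=` [set p | 0 <= p.2] -> (forall q, finite_set (S `&` box q)) -> pattern S s ->
  (forall (l : seq (R * R)) z z', (size l <= n)%N -> all (fun p => `|p.1 - p.2| <= delta) l ->
    0 <= Im z -> 0 <= Im z' -> normc (z - z') <= delta ->
    normc (foldl (fun w p => phi p.1 w) z l - foldl (fun w p => phi p.2 w) z' l) <= 1) ->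
  0 <= e -> 0 < l -> l + e <= delta -> d <= delta -> (0 < J)%N -> 0 <= x <= J%:R * l ->
  0 <= L -> L + 1 < Im (Fm S m t x%:C) ->
  exists j : 'I_J.+1, L <= Im (run (evolve k m d) (net e l j) s).
Proof.
move=> S0 fin pat cont e0 l0 led dd J0 xJ L0 LF.
have [q [sq aq Fq rq]] := pattern_Fm S s S0 fin pat.
(* In the default case the image is real, of height 0. *)
have [Fz|Fz] := Fq x%:C.
  by move: LF; rewrite Fz /=; lra.
have [|j jJ /in_cell] := cell_cover 0 l J x J0 l0; first by rewrite add0r.
rewrite !add0r -natr1 => /andP[x1 x2].
exists (widen_ord (leqnSn J) (Ordinal jJ)) => /=.
have := cont q x%:C (net e l j) sq; rewrite -Fz -rq => /(_ _ (lexx 0)) => H.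
have {H} : normc (Fm S m t x%:C - run (evolve k m d) (net e l j) s) <= 1.
  apply: H => //.
    by apply/allP => p /(allP aq) h; exact: le_trans h dd.
  rewrite /net complexBE sub0r; apply: le_trans (normc_le_ReIm _) _ => /=.
  rewrite normrN (ger0_norm e0) ger0_norm ?subr_ge0 //; lra.
move/(le_trans (normc_Im _)); rewrite ImB ler_norml => /andP[_ h]; lra.
Qed.

End Pattern.

(** * Poisson probabilities of the patterns *)

Section PoissonBound.
Context {R : realType} {d : measure_display} {T : measurableType d}.
Context (P : probability T R) (A : T -> set (R * R)).
Context (PA : poisson_point_process P A).

Lemma measure_disjoint_bigsetU (I : eqType) (s : seq I) (G : I -> set T) : uniq s ->
  (forall i, measurable (G i)) -> (forall i j, i != j -> G i `&` G j = set0) ->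
  P (\big[setU/set0]_(i <- s) G i) = (\sum_(i <- s) P (G i))%E.
Proof.
move=> + mG dG; elim: s => [|i s IH] /=; first by rewrite !big_nil measure0.
move=> /andP[si us]; rewrite !big_cons measureU ?IH //.
- by congr (_ + _)%E; exact: IH.
- by apply: bigsetU_measurable.
rewrite big_distrr /= big1_seq // => j /andP[_ js].
by rewrite dG //; apply: contraNneq si => ->.
Qed.

Context (k n : nat) (m w tau t : R).
Context (k0 : (0 < k)%N) (n0 : (0 < n)%N) (w0 : 0 < w) (tau0 : 0 < tau).
Context (kw : k%:R * w = 2 * m) (nt : n%:R * tau = t).
Implicit Types (s : n.-tuple (option 'I_k)).

Lemma measurable_box q : measurable (box k n m w tau q).
Proof. by apply: measurableX; exact: measurable_itv. Qed.

Lemma box_leb2 q : @leb2 R (box k n m w tau q) = (w * tau)%:E.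
Proof.
rewrite /leb2 /box product_measure1E; try exact: measurable_itv.
by rewrite EFinM -(lebesgue_cell (- m) w k q.2 w0) -(lebesgue_cell 0 tau n q.1 tau0).
Qed.

Lemma box_bounded q : Defs.bounded_set (box k n m w tau q).
Proof.
exists (m + t) => p /(box_sub k n m w tau t w0 tau0 kw nt) [/andP[h1 h2] /andP[h3 h4] _].
by rewrite /= !ler_norml; split; apply/andP; split; lra.
Qed.

Lemma prod_poisson (o : option 'I_k) (b : R) :
  \prod_(c < k) poisson_p b (o == Some c) =
  expR (- (k%:R * b)) * (if o is Some _ then b else 1).
Proof.
have E (j : bool) : poisson_p b j = expR (- b) * (if j then b else 1).
  by rewrite /poisson_p; case: j; rewrite /= ?expr1 ?expr0 divr1.
under eq_bigr do rewrite E.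
rewrite big_split /= prodr_const card_ord -expRM_natl mulrN; congr (_ * _).
rewrite -big_mkcond /=; case: o => [c|]; last by rewrite big_pred0.
by rewrite (big_pred1 c) // => c'; rewrite /= eq_sym.
Qed.

(** The counts in the [n * k] disjoint boxes of area [w * tau] are independent; the factors
    belonging to one slice multiply to its [weight]. *)
Lemma pattern_prob s :
  measurable [set v | pattern k n m w tau (A v) s] /\
  P [set v | pattern k n m w tau (A v) s] = (\prod_(o <- s) weight k w tau o)%:E.
Proof.
case: PA => _ [_ /(_ #|{: 'I_n * 'I_k}| (fun i => box k n m w tau (enum_val i))
  (fun i => (tnth s (enum_val i).1 == Some (enum_val i).2) : nat))] [].
- move=> i; split; first exact: measurable_box.
  split; first exact: box_bounded.
  by move=> p /(box_sub k n m w tau t w0 tau0 kw nt) [_ /andP[]].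
- move=> i j ij; apply: (box_disjoint k n m w tau w0 tau0).
  by apply: contraNneq ij => /enum_val_inj ->.
have -> : [set v | forall i : 'I_#|{: 'I_n * 'I_k}|, npoints (A v) (box k n m w tau (enum_val i)) =
    (tnth s (enum_val i).1 == Some (enum_val i).2) :> nat]
  = [set v | pattern k n m w tau (A v) s].
  apply/seteqP; split => v /= H; last by move=> i; exact: H.
  by move=> q; have := H (enum_rank q); rewrite enum_rankK.
move=> mE ->; split=> //; congr EFin.
have E q : poisson_p (fine (@leb2 R (box k n m w tau q))) = poisson_p (w * tau) by rewrite box_leb2.
rewrite (eq_bigr (fun i => poisson_p (w * tau) (tnth s (enum_val i).1 == Some (enum_val i).2))); last first.
  by move=> i _; rewrite (E (enum_val i)).
rewrite -(big_enum_val (fun q : 'I_n * 'I_k => poisson_p (w * tau) (tnth s q.1 == Some q.2))) /=.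
rewrite big_tuple (eq_bigr (fun i => \prod_(c < k) poisson_p (w * tau) (tnth s i == Some c))).
  by rewrite pair_big /=; apply: eq_bigl.
by move=> i _; rewrite prod_poisson.
Qed.

Lemma pattern_inj S s s' : pattern k n m w tau S s -> pattern k n m w tau S s' -> s = s'.
Proof.
move=> H H'; apply: eq_from_tnth => i.
have E c : (tnth s i == Some c) = (tnth s' i == Some c).
  by have := H (i, c); rewrite H' /=; do 2 case: eqP.
case E1 : (tnth s i) => [c|]; first by have := E c; rewrite E1 eqxx => /esym/eqP.
case E2 : (tnth s' i) => [c|] //; by have := E c; rewrite E1 E2 eqxx.
Qed.

Lemma bernoulli_ge (x : R) (j : nat) : 0 <= x <= 1 -> 1 - j%:R * x <= (1 - x) ^+ j.
Proof.
case/andP => x0 x1; elim: j => [|j IH]; first by rewrite mul0r subr0 expr0.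
rewrite exprS; apply: le_trans (_ : (1 - x) * (1 - j%:R * x) <= _); last by rewrite ler_wpM2l //; lra.
have : 0 <= j%:R * (x * x) by rewrite !mulr_ge0.
rewrite -natr1; nra.
Qed.

(* Some time slice contains several points, or the pattern belongs to [B]. *)
Definition exceptional (B : pred (n.-tuple (option 'I_k))) : set T :=
  ~` \big[setU/set0]_(s <- [seq s <- index_enum _ | ~~ B s]) [set v | pattern k n m w tau (A v) s].

Lemma exceptionalP B v : ~ exceptional B v -> exists2 s, ~~ B s & pattern k n m w tau (A v) s.
Proof.
rewrite /exceptional /= => /contrapT; rewrite -bigcup_seq => -[s /=].
by rewrite mem_filter => /andP[Bs _] H; exists s.
Qed.

Lemma measurable_exceptional B : measurable (exceptional B).
Proof.
by apply/measurableC/bigsetU_measurable => s _; have [] := pattern_prob s.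
Qed.

(** Distinct patterns are disjoint events of total mass [(expR (- mu) * (1 + mu))^n], which is at
    least [(1 - mu^2)^n >= 1 - n mu^2]. *)
Lemma exceptional_prob B : k%:R * (w * tau) <= 1 ->
  (P (exceptional B) <=
   (n%:R * (k%:R * (w * tau)) ^+ 2 + \sum_(s | B s) \prod_(o <- s) weight k w tau o)%:E)%E.
Proof.
set mu := k%:R * (w * tau) => mu1.
have mu0 : 0 <= mu by rewrite mulr_ge0 // mulr_ge0 // ltW.
rewrite /exceptional probability_setC; last first.
  by apply/bigsetU_measurable => s _; have [] := pattern_prob s.
rewrite measure_disjoint_bigsetU; last 3 first.
- by rewrite filter_uniq // index_enum_uniq.
- by move=> s; have [] := pattern_prob s.
- move=> s s' ss; apply/seteqP; split => // v [] /= H H'.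
  by move/eqP: ss; apply; exact: pattern_inj H H'.
rewrite (eq_bigr (fun s : n.-tuple (option 'I_k) => (\prod_(o <- s) weight k w tau o)%:E)); last first.
  by move=> s _; have [] := pattern_prob s.
rewrite sumEFin big_filter -EFinB lee_fin.
have : path_mean (weight k w tau) (fun _ (x : unit) => x) n (fun=> 1) tt = _ :=
  path_mean_total _ _ n tt.
rewrite /path_mean (bigID B) /= weight_total -/mu.
under eq_bigr do rewrite mulr1; under [X in _ + X]eq_bigr do rewrite mulr1.
move=> E; have -> : \sum_(s | ~~ B s) \prod_(o <- s) weight k w tau o
  = (expR (- mu) * (1 + mu)) ^+ n - \sum_(s | B s) \prod_(o <- s) weight k w tau o.
  by rewrite -E addrAC subrr add0r.
have : 1 - n%:R * mu ^+ 2 <= (expR (- mu) * (1 + mu)) ^+ n.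
  apply: le_trans (bernoulli_ge _ _ _) _; first by rewrite sqr_ge0 exprn_ile1.
  rewrite lerXn2r ?nnegrE ?mulr_ge0 ?expR_ge0 ?subr_ge0 ?exprn_ile1 //; first by lra.
  have := expR_ge1Dx (- mu); have := expR_ge0 (- mu); nra.
move: (\sum_(s | B s) _) => X; lra.
Qed.

End PoissonBound.

(** * The bound for the limit *)

Section FluctuationBound.
Context {R : realType} {d : measure_display} {T : measurableType d}.
Context (P : probability T R) (A : T -> set (R * R)).
Context (PA : poisson_point_process P A).
Context (a : nat) (a200 : (200 <= a)%N).

Lemma small_fraction (X b : R) : 0 < X -> 0 < b -> exists2 j : nat, (0 < j)%N & X / j%:R <= b.
Proof.
move=> X0 b0; exists (Num.truncn (X / b)).+1 => //.
rewrite ler_pdivrMr // mulrC -ler_pdivrMr // ltW // truncnS_gt //.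
Qed.

(** The order of choices matters: first the number [n] of slices, then the tolerance [delta], the
    height [e] and [K], then [D], and last the grid width [w] and the net spacing [l]. *)
Lemma window_bound (m t L eta : R) : 0 < m -> 0 < t -> 0 < eta -> 0 <= L ->
  a%:R <= 4 * (1 + L) ->
  exists E : set T, [/\ measurable E,
    [set v | exists x : R, 0 <= x <= t /\ L + 1 < Im (Fm (A v) m t x%:C)] `<=` E &
    (P E <= (eta + expR (2 * pi * t + 5) * (1 + 4 * (4 + a%:R) * t) / lyap a L)%:E)%E].
Proof.
move=> m0 t0 eta0 L0 aL.
have X0 : 0 < 2 * m * t by rewrite !mulr_gt0.
(* The mean number of points per slice is [mu = 2 m t / n]; this choice gives [n mu^2 <= eta] and
   [mu <= 1]. *)
have [n n0 nX] := small_fraction ((2 * m * t) ^+ 2 + 2 * m * t) (Num.min eta 1)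
  ltac:(by rewrite addr_gt0 // exprn_gt0) ltac:(by rewrite lt_min eta0 ltr01).
have {nX} [n1 n2] : (2 * m * t) ^+ 2 / n%:R <= eta /\ 2 * m * t / n%:R <= 1.
  move: nX; rewrite le_min mulrDl => /andP[h1 h2].
  have h3 : 0 <= (2 * m * t) ^+ 2 / n%:R by rewrite divr_ge0 // sqr_ge0.
  have h4 : 0 <= 2 * m * t / n%:R by rewrite divr_ge0 // ltW.
  by split; lra.
have nR : 0 < n%:R :> R by rewrite ltr0n.
have [delta /andP[de0 de1] cont] := foldl_phi_continuous n 1 (@ltr01 R).
pose e := delta / 2; have e0 : 0 < e by rewrite divr_gt0.
have e1 : e <= 1 by rewrite /e; lra.
pose K := 1 + e^-1; have K0 : 0 < K by rewrite addr_gt0 // invr_gt0.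
pose tau := t / n%:R; have tau0 : 0 < tau by rewrite divr_gt0.
have nt : n%:R * tau = t by rewrite mulrC divfK // gt_eqF.
have K3 : 0 < K ^+ 3 by rewrite exprn_gt0.
(* With [D = 1 / Q], both [(4 + a) D] and [20 m t K^3 D] are at most 1: the first linearises [lyap],
   the second bounds the error of the derivative. *)
pose Q := 4 + a%:R + 20 * (m * t * K ^+ 3).
have a0 : 0 <= a%:R :> R by [].
have Q1 : 0 < 20 * (m * t * K ^+ 3) by rewrite mulr_gt0 // !mulr_gt0.
have Q0 : 0 < Q by rewrite /Q; lra.
pose D := Q^-1; have D0 : 0 < D by rewrite invr_gt0.
have DQ : D * Q = 1 by rewrite mulVf // gt_eqF.
have DQ1 : 0 <= D * (4 + a%:R) by rewrite mulr_ge0 ?(ltW D0) //; lra.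
have DQ2 : 0 <= D * (20 * (m * t * K ^+ 3)) by rewrite mulr_ge0 ?ltW.
have DQ3 : D * (4 + a%:R) + D * (20 * (m * t * K ^+ 3)) = 1 by rewrite -mulrDr.
have [k k0 kX] := small_fraction (2 * m) (Num.min delta (16 * (m * t * K ^+ 3))^-1)
  ltac:(by rewrite mulr_gt0) ltac:(by rewrite lt_min de0 invr_gt0 mulr_gt0 // !mulr_gt0).
pose w := 2 * m / k%:R.
have kR : 0 < k%:R :> R by rewrite ltr0n.
have w0 : 0 < w by rewrite divr_gt0 // mulr_gt0.
have kw : k%:R * w = 2 * m by rewrite mulrC divfK // gt_eqF.
have {kX} [wd w1] : w <= delta /\ w * (16 * (m * t * K ^+ 3)) <= 1.
  move: kX; rewrite le_min -/w => /andP[-> h]; split=> //.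
  by rewrite -ler_pdivlMr ?div1r // mulr_gt0 // !mulr_gt0.
have [J J0 JX] := small_fraction t (Num.min (delta / 2) (D / K ^+ n))
  t0 ltac:(by rewrite lt_min !divr_gt0 ?exprn_gt0).
pose l := t / J%:R.
have JR : 0 < J%:R :> R by rewrite ltr0n.
have l0 : 0 < l by rewrite divr_gt0.
have Jl : J%:R * l = t by rewrite mulrC divfK // gt_eqF.
have {JX} [l1 l2] : l <= delta / 2 /\ l * K ^+ n <= D.
  move: JX; rewrite le_min -/l => /andP[-> h]; split=> //.
  by rewrite -ler_pdivlMr ?exprn_gt0.
pose B (s : n.-tuple (option 'I_k)) := [exists j : 'I_J.+1, L <= Im (run (evolve k m w) (net e l j) s)].
exists (exceptional A k n m w tau B); split.
- exact: (measurable_exceptional P A PA k n m w tau t w0 tau0 kw nt).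
- move=> v [x [xt Lx]]; apply: contrapT => /exceptionalP [s /negP sB pat]; apply: sB.
  apply/existsP; case: PA => pos [fin _].
  apply: (pattern_exceed k n m w tau t k0 n0 w0 tau0 kw nt e l delta L J (A v) s x) => //.
  + by move=> q; apply: fin; exact: (box_bounded k n m w tau t w0 tau0 kw nt).
  + exact: ltW.
  + by rewrite /e; lra.
  + by rewrite Jl.
have ktau : k%:R * (w * tau) = 2 * m * t / n%:R by rewrite mulrA kw /tau mulrA.
apply: le_trans (exceptional_prob P A PA k n m w tau t w0 tau0 kw nt B _) _.
  by rewrite ktau.
rewrite lee_fin; apply: lerD.
  rewrite ktau expr_div_n (_ : n%:R * ((2 * m * t) ^+ 2 / n%:R ^+ 2) = (2 * m * t) ^+ 2 / n%:R) //.
  by field; rewrite gt_eqF.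
(* With [E = 1 / t] the errors add only 1 to the exponent [2 pi t]; together with
   [lyap a e <= expR 4] this makes [2 pi t + 5]. *)
apply: le_trans (path_exceed a a200 k n m w tau e D t^-1 K e0 e1 w0 tau0 (ltW D0) erefl _
  l L J (ltW l0) _ l2 L0 aL) _.
- rewrite -div1r ler_pdivlMr //.
  have -> : (4 * k%:R * (K ^+ 3 * w ^+ 2) + 5 * (k%:R * w) * (K ^+ 3 * D)) * t
    = 4 * (k%:R * w) * K ^+ 3 * t * w + 5 * (k%:R * w) * K ^+ 3 * t * D by ring.
  rewrite kw; lra.
- by rewrite mulrC; lra.
rewrite ler_pM2r ?invr_gt0 ?lyap_gt0 // nt Jl.
have B0 : 0 <= 1 + 4 * (4 + a%:R) * t.
  by rewrite addr_ge0 // mulr_ge0 ?(ltW t0) // mulr_ge0 //; lra.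
rewrite ler_wpM2r // mulrDr divff ?gt_eqF //.
have le4 : lyap a e <= expR 4.
  apply: le_trans (_ : expR (4 * e) <= _); last by rewrite ler_expR; lra.
  rewrite /lyap ler_pdivrMr ?exprn_gt0 ?ler_peMr ?expR_ge0 ?exprn_ege1 //; lra.
have -> : expR (2 * pi * t + 5) = expR (t * (2 * pi) + 1) * expR 4.
  by rewrite -expRD; congr expR; ring.
by rewrite ler_wpM2l ?expR_ge0.
Qed.

(* A divergent [lim] has the junk value [0], so exceeding a positive level
   already forces convergence. *)
Lemma lim_exceed (f : R -> R) (L : R) : 0 < L -> L < lim (f @ +oo%R) ->
  exists M : R, forall m, M < m -> L < f m.
Proof.
move=> L0 Lf; have cf : cvg (f @ +oo%R).
  by apply: contrapT => /dvgP E; move: Lf; rewrite E /point /=; lra.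
have [M [_ HM]] := cvgr_gt _ cf _ Lf.
by exists M.
Qed.

(** Fatou's lemma for sets: the intersections increase with [N], and each lies in [E N]. *)
Lemma measure_liminf_le (E : nat -> set T) (v : \bar R) :
  (forall j, measurable (E j)) -> (forall j, P (E j) <= v)%E ->
  measurable (\bigcup_N \bigcap_(j in [set j | (N <= j)%N]) E j) /\
  (P (\bigcup_N \bigcap_(j in [set j | (N <= j)%N]) E j) <= v)%E.
Proof.
move=> mE Ev; set F := fun N => \bigcap_(j in [set j | (N <= j)%N]) E j.
have mF N : measurable (F N) by apply: bigcap_measurableType => j _.
have mU : measurable (\bigcup_N F N) by exact: bigcup_measurable.
split=> //.
have hF : {homo F : N N' / (N <= N')%N >-> (N <= N')%O}.
  by move=> N N' NN'; apply/subsetPset => x Fx j /= Nj; apply: Fx; exact: leq_trans Nj.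
have cF := nondecreasing_cvg_mu (mu := P) mF mU hF.
rewrite -(cvg_lim _ cF) //; apply: lime_le; first by apply/cvg_ex; eexists; exact: cF.
apply: nearW => N /=; apply: le_trans (Ev N).
by apply: le_measure; [exact/mem_set|exact/mem_set|move=> x; apply => /=].
Qed.

(** If the limit exceeds the level at some [x], then so does every large window at the same [x], and
    the outcome lies in all but finitely many of the sets [E j]. *)
Lemma fluctuation_bound (t L eta : R) : 0 < t -> 0 < eta -> 0 <= L -> a%:R <= 4 * (1 + L) ->
  exists E : set T, [/\ measurable E,
    [set v | exists x : R, 0 <= x <= t /\ L + 1 < Im (F (A v) t x%:C)] `<=` E &
    (P E <= (eta + expR (2 * pi * t + 5) * (1 + 4 * (4 + a%:R) * t) / lyap a L)%:E)%E].
Proof.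
move=> t0 eta0 L0 aL.
have /choice[E HE] j := window_bound j.+1%:R t L eta (ltr0Sn _ j) t0 eta0 L0 aL.
have [mU PU] := measure_liminf_le E _ (fun j => let: And3 h _ _ := HE j in h)
  (fun j => let: And3 _ _ h := HE j in h).
exists (\bigcup_N \bigcap_(j in [set j | (N <= j)%N]) E j); split=> //.
move=> v [x [xt Lx]].
have [|M HM] := lim_exceed _ (L + 1) _ Lx; first by lra.
exists (Num.truncn M) => // j /= Mj; have [_ + _] := HE j; apply; exists x; split=> //.
apply: HM; apply: lt_le_trans (truncnS_gt M) _; by rewrite ler_nat.
Qed.

End FluctuationBound.

(** * Choice of the level and of the constants *)

Lemma ln_le_linear {R : realType} (beta : R) : 0 < beta ->
  forall t, Num.max 1 (4 * beta ^+ 2) < t -> beta * ln t <= t.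
Proof.
move=> b0 t; rewrite gt_max => /andP[t1 tb].
have t0 : 0 < t by lra.
set r := Num.sqrt t; have r0 : 0 < r by rewrite sqrtr_gt0.
have rt : r ^+ 2 = t by rewrite sqr_sqrtr // ltW.
have -> : ln t = 2 * ln r by rewrite -rt lnXn // mulr_natl.
have lr : ln r <= r by apply: ltW; apply: ln_sublinear.
have br : 2 * beta <= r.
  by rewrite -(@ler_pXn2r _ 2) ?nnegrE ?(ltW r0) ?mulr_ge0 ?(ltW b0) // rt exprMn; lra.
rewrite -rt; nra.
Qed.

(* P( max_{x in [0,t]} Im M_t(x) > beta log t ) < c / t^(1/2), stated with the
   outer probability: the event is contained in a measurable event of
   probability < c / sqrt t. *)
Theorem theorem1p3 (R : realType) (d : measure_display) (T : measurableType d)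
    (P : probability T R) (A : T -> set (R * R)) :
  poisson_point_process P A ->
  exists c : R, 0 < c /\
  exists beta0 : R, forall beta : R, beta0 < beta ->
  exists t0 : R, forall t : R, t0 < t ->
  exists E : set T, measurable E /\
    [set w | exists x : R, 0 <= x <= t /\
       beta * ln t < complex.Im (M (A w) t x%:C)] `<=` E /\
    (P E < (c / Num.sqrt t)%:E)%E.
Proof.
move=> PA.
(* The exponent is kept abstract, with only its value as a real number known. *)
have [a a200 aE] : exists2 a, (200 <= a)%N & a%:R = 200 :> R by exists 200%N.
(* The bound 51 is what [4 beta >= a + 4] requires for [a = 200]. *)
exists 1; split => //; exists 51 => beta bb.
pose q : R := 1 + 4 * (4 + a%:R).
have q0 : 0 < q by rewrite /q aE; lra.
pose C : R := expR 9 * (q * 4 ^+ a).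
have C0 : 0 < C by apply: mulr_gt0; [exact: expR_gt0|apply: mulr_gt0 => //; exact: exprn_gt0].
(* The first maximum yields [beta ln t <= t], 50 yields [a <= 4 (1 + L)], and [4 C] absorbs the
   constant into one power of [t]. *)
exists (Num.max (Num.max 1 (4 * beta ^+ 2)) (Num.max 50 (4 * C))) => t.
rewrite !(gt_max t) => /andP[/andP[t1 tb] /andP[t50 tC]].
have t0 : 0 < t by lra.
have b0 : 0 < beta by lra.
have bt : beta * ln t <= t by apply: ln_le_linear; rewrite ?gt_max ?t1.
have ln0 : 0 <= ln t by apply: ln_ge0; lra.
have bln : 0 <= beta * ln t by rewrite mulr_ge0 // ltW.
have pi2 : 1 <= pi / 2 :> R := pihalf_ge1 R.
have pi4 : pi / 2 < 2 :> R := pihalf_lt2 R.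
have pt1 : t <= pi / 2 * t by rewrite ler_peMl // ltW.
have pt2 : pi / 2 * t <= 2 * t by rewrite ler_wpM2r // ltW.
(* The level [L + 1] is the drift of [Im F] plus [beta ln t]. *)
pose L := pi / 2 * t + beta * ln t - 1.
have L0 : 0 <= L by rewrite /L; lra.
have aL : a%:R <= 4 * (1 + L) by rewrite aE /L; lra.
have s0 : 0 < Num.sqrt t by rewrite sqrtr_gt0.
(* Each of the two terms of the bound will be at most [eta], a quarter of the target, which makes
   the final inequality strict. *)
pose eta := 1 / 4 / Num.sqrt t.
have eta0 : 0 < eta by rewrite !divr_gt0.
have [E [mE sE PE]] := fluctuation_bound P A PA a a200 t L eta t0 eta0 L0 aL.
exists E; split=> //; split.
  apply: subset_trans sE => v [x [xt]]; rewrite /M !ImB => H; exists x; split=> //.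
  by move: H; rewrite /= /L; lra.
apply: le_lt_trans PE _; rewrite lte_fin.
have st : Num.sqrt t <= t ^+ 2.
  rewrite -(@ler_pXn2r _ 2) ?nnegrE ?sqrtr_ge0 ?sqr_ge0 // sqr_sqrtr ?(ltW t0) // -exprM.
  by rewrite ler_eXnr // ltW.
suff : expR (2 * pi * t + 5) * (1 + 4 * (4 + a%:R) * t) / lyap a L <= eta.
  have -> : 1 / Num.sqrt t = 4 * eta by rewrite /eta; field; rewrite gt_eqF.
  lra.
apply: (@le_trans _ _ (1 / 4 / t ^+ 2)); last first.
  by rewrite /eta ler_wpM2l // lef_pV2 ?posrE // exprn_gt0.
have tn : t ^+ 2 != 0 by rewrite gt_eqF // exprn_gt0.
apply: (@le_trans _ _ (C / t ^+ 3)); last first.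
  have -> : C / t ^+ 3 = C / t / t ^+ 2 by field; rewrite gt_eqF.
  by rewrite ler_wpM2r ?invr_ge0 ?sqr_ge0 // ler_pdivrMr //; lra.
rewrite /lyap invf_div mulrA ler_pdivrMr ?expR_gt0 //.
(* The drift in [4 L] cancels the growth [expR (2 pi t)]; the constant 9 is 5 plus the 4 lost to the
   shift by 1. *)
have -> : expR (4 * L) = expR (2 * pi * t + 5) * expR (4 * (beta * ln t)) / expR 9.
  by rewrite -expRD -expRN -expRD; congr expR; rewrite /L; field.
have -> : C / t ^+ 3 * (expR (2 * pi * t + 5) * expR (4 * (beta * ln t)) / expR 9)
  = (q * 4 ^+ a) * expR (2 * pi * t + 5) * expR (4 * (beta * ln t)) / t ^+ 3.
  have e9 : expR 9 != 0 :> R by rewrite gt_eqF // expR_gt0.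
  by rewrite /C; move: (expR 9) e9 => x x0; field; rewrite x0 gt_eqF.
(* The power splits into [a] for [(1 + L)^a], one for the length of the interval and three for the
   decay [t^-3]. *)
have big : t ^+ (a + 4) <= expR (4 * (beta * ln t)).
  rewrite -[t in t ^+ _]lnK ?posrE // -expRM_natl ler_expR natrD aE mulrA ler_wpM2r //; lra.
have L4 : (1 + L) ^+ a <= 4 ^+ a * t ^+ a.
  by rewrite -exprMn lerXn2r ?nnegrE // /L ?mulr_ge0 //; lra.
rewrite ler_pdivlMr ?exprn_gt0 //.
have lin : 1 + 4 * (4 + a%:R) * t <= q * t by rewrite /q aE; lra.
have X0 := expR_ge0 (2 * pi * t + 5).
apply: (@le_trans _ _ (expR (2 * pi * t + 5) * (q * t) * (4 ^+ a * t ^+ a) * t ^+ 3)).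
  rewrite ler_wpM2r ?exprn_ge0 ?(ltW t0) //; apply: ler_pM => //.
  - by rewrite mulr_ge0 // aE; lra.
  - by rewrite exprn_ge0 // /L; lra.
  - by rewrite ler_wpM2l.
have -> : expR (2 * pi * t + 5) * (q * t) * (4 ^+ a * t ^+ a) * t ^+ 3
  = q * 4 ^+ a * expR (2 * pi * t + 5) * t ^+ (a + 4) by rewrite exprD; ring.
by apply: ler_wpM2l => //; apply: mulr_ge0 => //; apply: mulr_ge0; [exact: ltW|exact: exprn_ge0].
Qed.
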